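(* For every $\epsilon\in(0,1/2)$, it is NP-hard to approximate the group-closeness maximization problem within a factor of $4\cdot|V|^{-\epsilon}$, even on unweighted directed acyclic graphs. That is, unless $P=NP$ there is no polynomial-time algorithm that on every such instance returns $S\subseteq V$ with $|S|=k$ and $\mathrm{GC}(S)\ge 4|V|^{-\epsilon}\max\{\mathrm{GC}(T):T\subseteq V,|T|=k\}$.
   Context: For a directed graph $G=(V,E)$ with $n=|V|$, $\mathrm{dist}(u,v)$ is the shortest-path (hop) distance from $u$ to $v$ ($+\infty$ if no path), $\mathrm{dist}(S,v):=\min_{u\in S}\mathrm{dist}(u,v)$, and the group-closeness of $S$ is $\mathrm{GC}(S):=\frac{n}{\sum_{v\in V\setminus S}\mathrm{dist}(S,v)}$ (equal to $0$ when the sum is infinite). Group-closeness maximization: given $G$ and integer $k$, find $S\subseteq V$ with $|S|=k$ maximizing $\mathrm{GC}(S)$. *)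

(* Defs.v *)
From mathcomp Require Import all_boot all_order all_algebra.
From mathcomp Require Import all_classical all_reals all_analysis.

Set Implicit Arguments.
Unset Strict Implicit.
Unset Printing Implicit Defensive.

Import Order.TTheory GRing.Theory Num.Theory.

(** * Deterministic multitape Turing machines *)

(* A cell is blank ([None]), holds an input/output bit, or holds one of the
   finitely many extra symbols of the machine. *)
Definition symbol (A : Type) : Type := option (bool + A).

Inductive move := GoLeft | Stay | GoRight.

(* Two-way infinite; [left_of] lists the cells from the head outwards, and
   every cell beyond the two lists is blank. *)
Record tape (A : Type) := Tape {
  left_of : seq (symbol A);
  under_head : symbol A;
  right_of : seq (symbol A)
}.

Definition write_and_move (A : Type) (t : tape A) (am : symbol A * move) :
    tape A :=
  let: Tape l _ r := t in
  let: (a, m) := am in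
  match m with
  | GoLeft => Tape (behead l) (head None l) (a :: r)
  | Stay => Tape l a r
  | GoRight => Tape (a :: l) (head None r) (behead r)
  end.

(* The tapes are indexed by ['I_ntapes.+1], so there is always a tape 0. *)
Record machine := Machine {
  ntapes : nat;
  extra : finType;
  state : finType;
  start : state;
  halting : pred state;
  trans : state -> {ffun 'I_ntapes.+1 -> symbol extra} ->
          state * {ffun 'I_ntapes.+1 -> symbol extra * move}
}.

Definition config (M : machine) : Type :=
  (state M * {ffun 'I_(ntapes M).+1 -> tape (extra M)})%type.

Definition step (M : machine) (c : config M) : config M :=
  if halting c.1 then c else
  let: (q, act) := trans c.1 [ffun i => under_head (c.2 i)] in
  (q, [ffun i => write_and_move (c.2 i) (act i)]).

Definition word_tape (A : Type) (w : seq bool) : tape A :=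
  let s : seq (symbol A) := [seq Some (inl b) | b <- w] in
  Tape [::] (head None s) (behead s).

(* The i-th word is written on tape i; the remaining tapes are blank. *)
Definition init (M : machine) (ws : seq (seq bool)) : config M :=
  (start M, [ffun i : 'I_(ntapes M).+1 => word_tape (extra M) (nth [::] ws i)]).

Fixpoint leading_bits (A : Type) (s : seq (symbol A)) : seq bool :=
  if s is Some (inl b) :: s' then b :: leading_bits s' else [::].

(* The output is the maximal block of bits on tape 0 starting at the head. *)
Definition output (M : machine) (c : config M) : seq bool :=
  leading_bits (under_head (c.2 ord0) :: right_of (c.2 ord0)).

Definition outputs_within (M : machine) (ws : seq (seq bool)) (t : nat)
    (y : seq bool) : Prop :=
  let c := iter t (@step M) (init M ws) in halting c.1 /\ output c = y.

(** * The classes P and NP *)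

Local Open Scope classical_set_scope.
Local Open Scope ring_scope.

Definition language : Type := set (seq bool).

Definition input_size (ws : seq (seq bool)) : nat := sumn (map size ws).

Definition polytime_decidable (I : Type) (inp : I -> seq (seq bool))
    (D : I -> Prop) : Prop :=
  exists (M : machine) (p : {poly nat}), forall i, exists b : bool,
    outputs_within M (inp i) p.[input_size (inp i)] [:: b] /\ (D i <-> b).

Definition classP : set language :=
  [set L | polytime_decidable (fun x => [:: x]) L].

(* The verifier gets the instance on tape 0 and the certificate on tape 1. *)
Definition classNP : set language :=
  [set L | exists (V : seq bool * seq bool -> Prop) (q : {poly nat}),
     polytime_decidable (fun xw => [:: xw.1; xw.2]) V /\
     forall x, L x <-> exists w, (size w <= q.[size x])%N /\ V (x, w)].

(** * Group-closeness *)

Section GroupCloseness.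
Context (R : realType) (V : finType) (e : rel V).
Local Open Scope ereal_scope.

Definition acyclic : Prop := forall c : seq V, cycle e c -> c = [::].

Definition dist (u v : V) : \bar R :=
  ereal_inf [set (size p)%:R%:E | p in [set p | path e u p /\ last u p = v]].

Definition set_dist (S : {set V}) (v : V) : \bar R :=
  \big[mine/+oo]_(u in S) dist u v.

(* In [\bar R], [+oo^-1 = 0] and [0^-1 = +oo]; the denominator vanishes only
   for [S = V]. *)
Definition GC (S : {set V}) : \bar R :=
  #|V|%:R%:E / \sum_(v in ~: S) set_dist S v.

Definition max_GC (k : nat) : \bar R :=
  \big[maxe/0]_(T : {set V} | #|T| == k) GC T.

End GroupCloseness.

(** * Approximation algorithms *)

(* Number of vertices and k in unary, then the adjacency matrix row by row.
   Since k is at most the number of vertices, the unary notation changes the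
   instance size only polynomially. *)
Definition encode_instance (n : nat) (e : rel 'I_n) (k : nat) : seq bool :=
  nseq n true ++ false :: nseq k true ++ false ::
  [seq e u v | u <- enum 'I_n, v <- enum 'I_n].

Definition encode_set (n : nat) (S : {set 'I_n}) : seq bool :=
  [seq u \in S | u <- enum 'I_n].

(* Nothing is required of the machine on words that encode no instance. *)
Definition polytime_approximable_on_dags (R : realType) (alpha : nat -> R) :
    Prop :=
  exists (M : machine) (p : {poly nat}),
  forall (n : nat) (e : rel 'I_n) (k : nat), acyclic e -> (k <= n)%N ->
  exists S : {set 'I_n},
  [/\ outputs_within M [:: encode_instance e k]
        p.[size (encode_instance e k)] (encode_set S),
      #|S| = k
    & ((alpha n)%:E * max_GC R e k <= GC R e S)%E].

(* The factor 4 n^-eps, capped at 1. Without the cap it exceeds 1 when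
   n < 4^(1/eps), and then no set meets the guarantee if the maximum is finite
   and positive (one edge and k = 1, for instance): inapproximability would hold
   vacuously, whether or not P = NP. As the cap only relaxes the guarantee,
   inapproximability within the capped factor implies inapproximability within
   4 n^-eps. *)
Definition gc_factor (R : realType) (eps : R) (n : nat) : R :=
  Num.min 1 (4 * n%:R `^ (- eps)).

(* Main.v *)
Require Import Defs.
From mathcomp Require Import all_boot all_order all_algebra.
From mathcomp Require Import all_classical all_reals all_analysis.
From mathcomp Require Import zify lra.

Set Implicit Arguments.
Unset Strict Implicit.
Unset Printing Implicit Defensive.

(* Whether a verifier accepts some certificate within polynomial time is a
   question about a tableau of cells (t, j): row t describes the tapes after t
   steps, j being a position relative to the heads, so that the rows are related
   by constraints between neighbouring cells. Choosing the content of every cell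
   is a set cover problem: the sets are the pairs of a cell and a value, the
   elements are the cells and the forbidden local patterns, and a cover by as
   many sets as there are cells is a correct accepting tableau.

   In the graph, a root starts, for every set, a chain of L vertices; the end of
   the chain points to the M copies of each element that the set covers. With k =
   1 + number of cells, a cover together with the root puts every copy at
   distance 1, whereas if the k chosen vertices do not meet the chains of a
   cover, almost all copies of some element are at distance > L. For M = L^2 much
   larger than the tableau, the gap is |V|^(1/2) up to a power of the tableau
   size, which beats |V|^eps for L large. So the set returned by an
   approximation algorithm tells whether a cover exists.

   The vertices are tuples of numbers below powers of N + 2, N being the input
   length, and adjacency compares coordinates. A machine enumerates the tuples by
   nested loops over base-(N + 2) digits and keeps, for all counters X and Y, a
   tape whose head is X - Y cells away from its origin. Each of its tests then
   only reads the symbols under the heads. *)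

Import Order.TTheory GRing.Theory Num.Theory.

(** * Tapes as functions on the integers *)

Local Open Scope ring_scope.

(* The argument is the position relative to the head. *)
Definition atape (A : Type) := int -> symbol A.

Definition abs_tape (A : Type) (t : tape A) : atape A := fun z =>
  match z with
  | Posz 0 => under_head t
  | Posz n.+1 => nth None (right_of t) n
  | Negz n => nth None (left_of t) n
  end.

Definition mvd (m : move) : int :=
  match m with GoLeft => -1 | Stay => 0 | GoRight => 1 end.

Definition put (A : Type) (a : symbol A) (t : atape A) : atape A :=
  fun z => if z == 0 then a else t z.

(** Positions are relative to the head, so a move of the head translates the content. *)
Definition awm (A : Type) (t : atape A) (am : symbol A * move) : atape A :=
  fun z => put am.1 t (z + mvd am.2).

Lemma abs_tape_wm (A : Type) (t : tape A) am :
  abs_tape (write_and_move t am) = awm (abs_tape t) am.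
Proof.
case: t => l u r; case: am => a m; apply/funext => z; rewrite /awm /put.
case: m; rewrite [mvd _]/=.
- case: z => [[|n]|n].
  + by case: l.
  + have -> : Posz n.+1 + -1 = Posz n by lia.
    by case: n.
  + have -> : Negz n + -1 = Negz n.+1 by lia.
    by rewrite /= nth_behead.
- by rewrite addr0; case: z => [[|n]|n].
- case: z => [[|n]|[|n]].
  + by case: r.
  + have -> : Posz n.+1 + 1 = Posz n.+2 by lia.
    by rewrite /= nth_behead.
  + by [].
  + by have -> : Negz n.+1 + 1 = Negz n by lia.
Qed.

Lemma awm_stay (A : Type) (t : atape A) : awm t (t 0, Stay) = t.
Proof. by apply/funext => z; rewrite /awm /put /= addr0; case: eqP => [->|]. Qed.

(** The word [w] starts at a fixed origin, everything else is blank, and the head is at cell [p],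
    which may lie outside the word on either side. *)
Definition wt (A : Type) (w : seq (symbol A)) (p : int) : atape A := fun z =>
  if z + p is Posz n then nth None w n else None.

Lemma wt_right (A : Type) (w : seq (symbol A)) p :
  awm (wt w p) (wt w p 0, GoRight) = wt w (p + 1).
Proof.
apply/funext => z; rewrite /awm /put /=; case: eqP => [z1|_].
  by rewrite /wt; have -> : z + (p + 1) = 0 + p by lia.
by rewrite /wt; have -> : z + 1 + p = z + (p + 1) by lia.
Qed.

Lemma wt_left (A : Type) (w : seq (symbol A)) p :
  awm (wt w p) (wt w p 0, GoLeft) = wt w (p - 1).
Proof.
apply/funext => z; rewrite /awm /put /=; case: eqP => [z1|_].
  by rewrite /wt; have -> : z + (p - 1) = 0 + p by lia.
by rewrite /wt; have -> : z - 1 + p = z + (p - 1) by lia.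
Qed.

Lemma wt_put (A : Type) (w : seq (symbol A)) (n : nat) a :
  (n <= size w)%N -> put a (wt w n) = wt (set_nth None w n a) n.
Proof.
move=> nw; apply/funext => z; rewrite /put /wt; case: eqP => [->|z0].
  by rewrite add0r nth_set_nth /= eqxx.
case E: (z + n) => [k|k] //; rewrite nth_set_nth /=; case: eqP => // kn; lia.
Qed.

Lemma wt_append (A : Type) (w : seq (symbol A)) a :
  awm (wt w (size w)) (a, GoRight) = wt (rcons w a) (size (rcons w a)).
Proof.
transitivity (fun z => put a (wt w (size w)) (z + 1)); first by [].
rewrite wt_put //; apply/funext => z; rewrite /wt size_rcons.
have -> : set_nth None w (size w) a = rcons w a.
  by elim: w => //= x w ->.
by have -> : z + 1 + size w = z + (size w).+1 by lia.
Qed.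

Lemma wt_nat (A : Type) (w : seq (symbol A)) (n : nat) : wt w n 0 = nth None w n.
Proof. by rewrite /wt add0r. Qed.

Lemma abs_word_tape (A : Type) (w : seq bool) :
  abs_tape (word_tape A w) = wt [seq Some (inl b) | b <- w] 0.
Proof.
apply/funext => z; rewrite /wt addr0; case: z => [[|n]|n] /=.
- by case: w.
- by rewrite nth_behead.
- by rewrite nth_nil.
Qed.

(** * Machines over an arbitrary finite set of tapes *)

Record gmach (I A : finType) := GMach {
  st : finType;
  st0 : st;
  hl : pred st;
  tr : st -> (I -> symbol A) -> st * (I -> symbol A * move)
}.

Section Machines.
Variables I A : finType.
Implicit Types (M : gmach I A) (T : I -> atape A) (r : I -> symbol A).

Definition keep r (i : I) : symbol A * move := (r i, Stay).

Definition gconf M : Type := (st M * (I -> atape A))%type.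

Definition upd T (act : I -> symbol A * move) : I -> atape A :=
  fun i => awm (T i) (act i).

Definition heads T : I -> symbol A := fun i => T i 0.

Lemma upd_keep T : upd T (keep (heads T)) = T.
Proof. by apply/funext => i; exact: awm_stay. Qed.

Definition gstep M (c : gconf M) : gconf M :=
  if hl c.1 then c else
  ((tr c.1 (heads c.2)).1, upd c.2 (tr c.1 (heads c.2)).2).

(** Counts the steps up to the first halting state, where iterating [gstep] would idle. The
    composition lemmas are inductions on it. *)
Inductive exec M : nat -> gconf M -> (I -> atape A) -> Prop :=
| ExecHalt q T : hl q -> exec 0 (q, T) T
| ExecStep q T n T' : ~~ hl q ->
    exec n ((tr q (heads T)).1, upd T (tr q (heads T)).2) T' ->
    exec n.+1 (q, T) T'.

Lemma exec_iter M n (c : gconf M) T' t : exec n c T' -> (n <= t)%N ->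
  hl (iter t (@gstep M) c).1 /\ (iter t (@gstep M) c).2 = T'.
Proof.
move=> E; elim: E t => {n c T'} [q T hq|q T n T' hq E IH] t nt.
  have -> : iter t (@gstep M) (q, T) = (q, T); last by [].
  by elim: t {nt} => //= t ->; rewrite /gstep /= hq.
case: t nt => // t nt; rewrite iterSr.
have -> : gstep (q, T) = ((tr q (heads T)).1, upd T (tr q (heads T)).2) :> gconf M.
  by rewrite /gstep /= (negbTE hq).
exact: IH.
Qed.

Lemma iter_exec M n (c : gconf M) : hl (iter n (@gstep M) c).1 ->
  exists2 m, (m <= n)%N & exec m c (iter n (@gstep M) c).2.
Proof.
elim: n c => [|n IH] [q T] /=.
  by move=> hq; exists 0%N => //; exact: ExecHalt.
rewrite -iterS iterSr; case hq : (hl q).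
  have -> : gstep (q, T) = (q, T) :> gconf M by rewrite /gstep /= hq.
  by move=> /IH[m mn E]; exists m => //; exact: leqW.
move=> /IH[m mn]; rewrite {1}/gstep /= hq => E.
by exists m.+1 => //; apply: ExecStep => //; rewrite hq.
Qed.

Definition runs M T T' (t : nat) : Prop :=
  exists2 n, (n <= t)%N & exec n ((st0 M, T) : gconf M) T'.

Lemma runs_le M T T' t t' : runs M T T' t -> (t <= t')%N -> runs M T T' t'.
Proof. by case=> n nt E tt'; exists n => //; exact: leq_trans tt'. Qed.

Definition Act (f : (I -> symbol A) -> I -> symbol A * move) : gmach I A :=
  @GMach I A bool false id (fun _ r => (true, f r)).

Lemma runs_Act f T : runs (Act f) T (upd T (f (heads T))) 1.
Proof. by exists 1%N => //; apply: ExecStep => //; apply: ExecHalt. Qed.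

Definition Seq M1 M2 : gmach I A :=
  @GMach I A (st M1 + st M2)%type (inl (st0 M1))
    (fun q => if q is inr q2 then hl q2 else false)
    (fun q r => match q with
      | inl q1 => if hl q1 then (inr (st0 M2), keep r)
                  else (inl (tr q1 r).1, (tr q1 r).2)
      | inr q2 => (inr (tr q2 r).1, (tr q2 r).2)
      end).

(** The extra step leads from a halting state of [M1] to the start of [M2]; it leaves all tapes as
    they are. *)
Lemma runs_Seq M1 M2 T1 T2 T3 t1 t2 :
  runs M1 T1 T2 t1 -> runs M2 T2 T3 t2 ->
  runs (Seq M1 M2) T1 T3 (t1 + t2 + 1).
Proof.
case=> n1 n1t E1 [n2 n2t E2]; exists (n1 + (n2.+1))%N; first by lia.
have E2' : exec n2 ((inr (st0 M2), T2) : gconf (Seq M1 M2)) T3.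
  have : forall c, exec n2 c T3 ->
    exec n2 ((inr c.1, c.2) : gconf (Seq M1 M2)) T3.
    move=> c; elim => [q T hq|q T n T' hq E IH].
      exact: (@ExecHalt (Seq M1 M2) (inr q)).
    exact: (@ExecStep (Seq M1 M2) (inr q)).
  by move=> /(_ _ E2).
have : forall c, exec n1 c T2 ->
  exec (n1 + n2.+1) ((inl c.1, c.2) : gconf (Seq M1 M2)) T3.
  move=> c E; elim: E E2' => [q T hq|q T n T' hq E IH] E2' /=.
    by rewrite add0n; apply: ExecStep => //=; rewrite hq /= upd_keep.
  by rewrite addSn; apply: ExecStep => //=; rewrite (negbTE hq); exact: IH.
by move=> /(_ _ E1).
Qed.

Definition While (c : (I -> symbol A) -> bool) M : gmach I A :=
  @GMach I A (bool + st M)%type (inl true)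
    (fun q => if q is inl false then true else false)
    (fun q r => match q with
      | inl _ => (if c r then inr (st0 M) else inl false, keep r)
      | inr q => if hl q then (inl true, keep r) else (inr (tr q r).1, (tr q r).2)
      end).

(** Each round costs two steps besides the body, the test and the return to it; the final 1 is the
    failing test. *)
Lemma runs_While (c : (I -> symbol A) -> bool) M (T : nat -> I -> atape A) (n t : nat) :
  (forall i, (i < n)%N -> c (heads (T i)) /\ runs M (T i) (T i.+1) t) ->
  c (heads (T n)) = false ->
  runs (While c M) (T 0%N) (T n) (n * (t + 2) + 1).
Proof.
elim: n T => [|n IH] T Hi Hn.
  exists 1%N => //; apply: ExecStep => //=; rewrite Hn upd_keep.
  exact: ExecHalt.
have [c0 [m mt E]] := Hi 0%N isT.
have [m' m't E'] := IH (fun i => T i.+1) (fun i ii => Hi i.+1 ii) Hn.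
exists (m + m'.+1).+1; first by lia.
apply: ExecStep => //=; rewrite c0 upd_keep.
have : forall c1, exec m c1 (T 1%N) ->
  exec (m + m'.+1) ((inr c1.1, c1.2) : gconf (While c M)) (T n.+1).
  move=> c1; move: E'; move: (T 1%N) => T1 E' E1.
  elim: E1 E' => [q T2 hq|q T2 k T1' hq _ IHk] E' /=.
    by rewrite add0n; apply: ExecStep => //=; rewrite hq upd_keep.
  by rewrite addSn; apply: ExecStep => //=; rewrite (negbTE hq); exact: IHk.
by move=> /(_ _ E).
Qed.

Lemma runs_Seqs (X : Type) (P : X -> gmach I A) (xs : seq X)
    (C : nat -> I -> atape A) (t : nat) :
  (forall i x0, (i < size xs)%N -> runs (P (nth x0 xs i)) (C i) (C i.+1) t) ->
  runs (foldr (fun x M => Seq (P x) M) (Act keep) xs) (C 0%N) (C (size xs))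
    (size xs * t.+1 + 1).
Proof.
elim: xs C => [|x xs IH] C H /=.
  by rewrite -[in X in runs _ _ X _](upd_keep (C 0%N)); exact: runs_Act.
apply: (@runs_le _ _ _ (t + (size xs * t.+1 + 1) + 1)); last by lia.
apply: runs_Seq (H 0%N x _) _ => //.
by apply: (IH (fun i => C i.+1)) => i x0 ii; exact: (H i.+1).
Qed.

End Machines.

(** * Embedding of a machine *)

Section Embedding.
Variables (I : finType) (B : machine).
Variables (emb : 'I_(ntapes B).+1 -> I) (proj : I -> option 'I_(ntapes B).+1).

Definition Emb : gmach I (extra B) :=
  @GMach I (extra B) (state B) (start B) (@halting B)
    (fun q r => let qa := trans q [ffun j => r (emb j)] in
       (qa.1, fun i => if proj i is Some j then qa.2 j else keep r i)).

Definition abs_conf (c : config B) : 'I_(ntapes B).+1 -> atape (extra B) :=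
  fun j => abs_tape (c.2 j).

Definition glue (T : I -> atape (extra B)) (U : 'I_(ntapes B).+1 -> atape (extra B)) :
    I -> atape (extra B) :=
  fun i => if proj i is Some j then U j else T i.

Hypothesis projK : forall j, proj (emb j) = Some j.

Lemma gstep_Emb T (c : config B) :
  gstep ((c.1, glue T (abs_conf c)) : gconf Emb) =
  ((step c).1, glue T (abs_conf (step c))).
Proof.
case: c => q U; rewrite /gstep /step /=; case: (halting q) => //.
have -> : [ffun j => heads (glue T (abs_conf (q, U))) (emb j)] =
          [ffun i => under_head (U i)].
  by apply/ffunP => j; rewrite !ffunE /heads /glue projK.
case: (trans q _) => q' act /=; congr pair; apply/funext => i.
rewrite /upd /glue; case E : (proj i) => [j|]; rewrite ?E.
  by rewrite /abs_conf /= ffunE abs_tape_wm.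
by rewrite /keep /heads E awm_stay.
Qed.

Lemma runs_Emb T (c : config B) (t : nat) :
  c.1 = start B -> halting (iter t (@step B) c).1 ->
  runs Emb (glue T (abs_conf c)) (glue T (abs_conf (iter t (@step B) c))) t.
Proof.
move=> c1 ht.
have E n : iter n (@gstep _ _ Emb) (st0 Emb, glue T (abs_conf c)) =
    ((iter n (@step B) c).1, glue T (abs_conf (iter n (@step B) c))).
  elim: n => [|n IH]; first by rewrite /= -c1.
  by rewrite !iterS IH gstep_Emb.
have := @iter_exec _ _ Emb t (st0 Emb, glue T (abs_conf c)).
by rewrite E => /(_ ht)[m mt Em]; exists m.
Qed.
End Embedding.

(** * Back to machines with numbered tapes *)

Section ToMachine.
Variables (J A : finType) (M : gmach (option J) A).

(** Tape [None] becomes tape 0, which carries both the input and the output. *)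
Definition tape_of (i : 'I_#|{: J}|.+1) : option J :=
  if unlift ord0 i is Some k then Some (enum_val k) else None.
Definition of_tape (o : option J) : 'I_#|{: J}|.+1 :=
  if o is Some j then lift ord0 (enum_rank j) else ord0.

Lemma of_tapeK : cancel of_tape tape_of.
Proof.
case=> [j|]; rewrite /tape_of /of_tape; last by rewrite unlift_none.
by rewrite liftK enum_rankK.
Qed.

Definition to_machine : machine :=
  @Machine #|{: J}| A (st M) (st0 M) (@hl _ _ M)
    (fun q r => let qa := tr q (fun o => r (of_tape o)) in
       (qa.1, [ffun i => qa.2 (tape_of i)])).

Lemma to_machine_step (c : config to_machine) :
  gstep ((c.1, fun o => abs_tape (c.2 (of_tape o))) : gconf M) =
  ((step c).1, fun o => abs_tape ((step c).2 (of_tape o))).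
Proof.
case: c => q U; rewrite /gstep /step /=; case: (hl q) => //=.
have -> : heads (fun o => abs_tape (U (of_tape o))) =
   (fun o => [ffun i => under_head (U i)] (of_tape o)).
  by apply/funext => o; rewrite ffunE.
congr pair; apply/funext => o.
by rewrite /upd ffunE abs_tape_wm ffunE of_tapeK.
Qed.

(** The blank at position 1 cuts the output off after a single bit. *)
Lemma to_machine_outputs (x : seq bool) T' (t : nat) (b : bool) :
  runs M (fun o => wt (if o is None then [seq Some (inl b) | b <- x] else [::]) 0)
    T' t ->
  T' None 0 = Some (inl b) -> T' None 1 = None ->
  outputs_within to_machine [:: x] t [:: b].
Proof.
case=> n nt /exec_iter /(_ nt) [] h1 h2 T0 T1; rewrite /outputs_within.
set c := init _ _.
have E k : iter k (@gstep _ _ M) (st0 M, fun o => abs_tape (c.2 (of_tape o))) =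
    ((iter k (@step to_machine) c).1,
     fun o => abs_tape ((iter k (@step to_machine) c).2 (of_tape o))).
  elim: k => [//|k IH]; by rewrite !iterS IH to_machine_step.
have e0 : (fun o => abs_tape (c.2 (of_tape o))) =
   (fun o : option J =>
     wt (if o is None then [seq Some (inl b) | b <- x] else [::]) 0).
  apply/funext => -[j|]; rewrite /c /init /= ffunE abs_word_tape //=.
  by rewrite /bump /= nth_nil.
move: h1 h2; rewrite -e0 E /= => h1 h2; split=> //.
move: (congr1 (fun T => T None 0) h2) (congr1 (fun T => T None 1) h2).
rewrite T0 T1 /output /=.
by case: ((iter t _ c).2 ord0) => l u [|r1 r] /= -> //= ->.
Qed.
End ToMachine.

Lemma output_nth (B : machine) (c : config B) (y : seq bool) : output c = y ->
  forall i, (i < size y)%N -> abs_conf c ord0 i = Some (inl (nth false y i)).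
Proof.
rewrite /output /abs_conf; case: (c.2 ord0) => l u r <- i ii.
have : forall (s : seq (symbol (extra B))) i, (i < size (leading_bits s))%N ->
   nth None s i = Some (inl (nth false (leading_bits s) i)).
  by elim=> // -[[b|a]|] s IH [|k] //= /IH.
by move=> H; have := H (u :: r) i ii; case: i {ii}.
Qed.

(** * Polynomially bounded functions *)

(** The base [N + 2] is at least 2 even for the empty input, so constants and sums are absorbed by a
    larger exponent. *)
Definition pbound (f : nat -> nat) : Prop :=
  exists d, forall N, (f N <= (N + 2) ^ d)%N.

Lemma pbound_le f g : (forall N, (f N <= g N)%N) -> pbound g -> pbound f.
Proof. by move=> fg [d H]; exists d => N; exact: leq_trans (H N). Qed.

Lemma pbound_const c : pbound (fun=> c).
Proof.
exists c => N; apply: leq_trans (ltnW (ltn_expl c (isT : (1 < 2)%N))) _.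
by case: c => // c; rewrite leq_exp2r // leq_addl.
Qed.

Lemma pbound_id : pbound id.
Proof. by exists 1%N => N; rewrite expn1 leq_addr. Qed.

Lemma pboundM f g : pbound f -> pbound g -> pbound (fun N => f N * g N)%N.
Proof. by case=> d Hf [e Hg]; exists (d + e)%N => N; rewrite expnD leq_mul. Qed.

Lemma pboundD f g : pbound f -> pbound g -> pbound (fun N => f N + g N)%N.
Proof.
case=> d Hf [e Hg]; exists (d + e + 1)%N => N.
apply: (leq_trans (leq_add (Hf N) (Hg N))).
rewrite expnD expn1 expnD.
have H1 : (0 < (N + 2) ^ d)%N by rewrite expn_gt0 addn2.
have H2 : (0 < (N + 2) ^ e)%N by rewrite expn_gt0 addn2.
have H3 : ((N + 2) ^ d <= (N + 2) ^ d * (N + 2) ^ e)%N by rewrite leq_pmulr.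
have H4 : ((N + 2) ^ e <= (N + 2) ^ d * (N + 2) ^ e)%N by rewrite leq_pmull.
nia.
Qed.

Lemma horner_nat_mono (p : {poly nat}) (a b : nat) : (a <= b)%N -> (p.[a] <= p.[b])%N.
Proof.
move=> ab; elim/poly_ind: p => [|p c IH]; first by rewrite !horner0.
by rewrite !hornerMXaddC leq_add2r leq_mul.
Qed.

Lemma pbound_horner (p : {poly nat}) f : pbound f -> pbound (fun N => p.[f N]).
Proof.
move=> Hf; elim/poly_ind: p => [|p c IH].
  by apply: pbound_le (pbound_const 0) => N; rewrite horner0.
apply: (@pbound_le _ (fun N => p.[f N] * f N + c)%N) => [N|].
  by rewrite hornerMXaddC.
by apply: pboundD; [exact: pboundM | exact: pbound_const].
Qed.

Lemma pbound_poly f : pbound f -> exists p : {poly nat}, forall N, (f N <= p.[N])%N.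
Proof.
case=> d H; exists (('X + 2%:P) ^+ d) => N.
by apply: leq_trans (H N) _; rewrite horner_exp hornerD hornerX hornerC.
Qed.

(** * Counters and what the heads observe of them *)

Lemma wt_move (A : Type) (w : seq (symbol A)) p m :
  awm (wt w p) (wt w p 0, m) = wt w (p + mvd m).
Proof.
by case: m; [rewrite wt_left | rewrite addr0 awm_stay | rewrite wt_right].
Qed.

Definition obs_bit (A : Type) (a : symbol A) : option bool :=
  if a is Some (inl b) then Some b else None.

Definition bits (A : Type) (w : seq bool) : seq (symbol A) :=
  [seq Some (inl b) | b <- w].
Arguments bits : clear implicits.

(* Tu, Ju, Zu and Tv, Jv, Zv are the coordinates of two vertices u and v; the
   other counters are constants during the enumeration: 0, the column where the
   heads stand, the numbers of rows and of columns, the first column to the right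
   of any admissible certificate, and the length of the chains. *)
Definition Ctr : finType := 'I_12.
Definition cval : Type := Ctr -> nat.
Definition setv (v : cval) (X : Ctr) (n : nat) : cval :=
  fun Y => if Y == X then n else v Y.

Definition Tu : Ctr := @Ordinal 12 0 isT.
Definition Ju : Ctr := @Ordinal 12 1 isT.
Definition Zu : Ctr := @Ordinal 12 2 isT.
Definition Tv : Ctr := @Ordinal 12 3 isT.
Definition Jv : Ctr := @Ordinal 12 4 isT.
Definition Zv : Ctr := @Ordinal 12 5 isT.
Definition CO : Ctr := @Ordinal 12 6 isT.
Definition CW : Ctr := @Ordinal 12 7 isT.
Definition CT : Ctr := @Ordinal 12 8 isT.
Definition CJ : Ctr := @Ordinal 12 9 isT.
Definition CQ : Ctr := @Ordinal 12 10 isT.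
Definition CL : Ctr := @Ordinal 12 11 isT.

Lemma setv_id v X : setv v X (v X) = v.
Proof. by apply/funext => Y; rewrite /setv; case: eqP => [->|]. Qed.
Lemma setv_setv v X m n : setv (setv v X m) X n = setv v X n.
Proof. by apply/funext => Y; rewrite /setv; case: eqP. Qed.
Lemma setv_same v X n : setv v X n X = n.
Proof. by rewrite /setv eqxx. Qed.

(* What the head symbols reveal about the counters and the input. *)
Definition obs : Type := ((Ctr -> Ctr -> option bool) * option bool)%type.

(** The bit found at position [m - n] of a counter tape, which holds a mark at 0, a false bit at 1
    and blanks elsewhere. *)
Definition cmp (m n : nat) : option bool :=
  if m == n then Some true else if m == n.+1 then Some false else None.

Definition ob (x : seq bool) (v : cval) : obs :=
  (fun X Y => cmp (v X) (v Y),
   if (v Jv)%:Z - (v CW)%:Z is Posz n then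
     if (n < size x)%N then Some (nth false x n) else None
   else None).

(** * Iterated relations, the specifications of loops *)

Fixpoint relpow (S : Type) (R : S -> S -> Prop) (n : nat) (s s' : S) : Prop :=
  if n is m.+1 then exists2 u, R s u & relpow R m u s' else s = s'.

Lemma relpow_chain (S : Type) (R : S -> S -> Prop) n s s' :
  relpow R n s s' <->
  exists C : nat -> S, [/\ C 0%N = s, C n = s' &
    forall i, (i < n)%N -> R (C i) (C i.+1)].
Proof.
elim: n s => [|n IH] s /=.
  split=> [<-|[C [<- <- _]] //]; by exists (fun=> s).
split=> [[u Rsu /IH[C [C0 Cn HC]]]|[C [<- Cn HC]]].
  exists (fun i => if i is j.+1 then C j else s); split=> // -[|i] ii.
    by rewrite C0.
  exact: HC.
exists (C 1%N); first exact: HC.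
by apply/IH; exists (fun i => C i.+1); split=> // i ii; exact: HC.
Qed.

Lemma relpowD (S : Type) (R : S -> S -> Prop) m n s s' :
  relpow R (m + n) s s' -> exists2 u, relpow R m s u & relpow R n u s'.
Proof.
elim: m s => [|m IH] s /=; first by exists s.
by case=> u Rsu /IH[w H1 H2]; exists w => //; exists u.
Qed.

(** Used for nested loops: [n] rounds of an inner loop of [m] rounds can realize any [n * m]
    transitions of the body. *)
Lemma relpowM (S : Type) (R : S -> S -> Prop) m n s s' :
  relpow R (n * m) s s' -> relpow (relpow R m) n s s'.
Proof.
elim: n s => [|n IH] s //.
by rewrite mulSn => H; have [u H1 H2] := relpowD H; exists u => //; exact: IH.
Qed.

(** * Programs on digit, counter and payload tapes *)

Section Programs.
Variables (B : machine) (D1 D : nat).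

Definition alphabet : finType := extra B.
Local Notation A := alphabet.
Definition payload_tape : finType := ('I_(ntapes B).+1 + bool)%type.
Definition work_tape : finType := ('I_D + (Ctr * Ctr) + payload_tape)%type.
Definition tapes : finType := option work_tape.
Local Notation I := tapes.

Definition tD (k : 'I_D) : I := Some (inl (inl k)).
Definition tC (X Y : Ctr) : I := Some (inl (inr (X, Y))).
Definition tP (i : payload_tape) : I := Some (inr i).
(* The instance is written on, and the returned set read from, the first tape of
   the embedded machine. *)
Definition tOut : payload_tape := inl ord0.
Definition tFlag : payload_tape := inr false.
Definition tRes : payload_tape := inr true.

Definition mark : symbol A := Some (inl true).

(** The first [D1] digit tapes drive loops over digits in base [N + 2]; the remaining ones, with [N]
    marks, serve to compute powers of [N]. *)
Definition marks (N k : nat) : nat := if (k < D1)%N then (N + 2)%N else N.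

Definition payload : Type := payload_tape -> atape A.

(* The input tape doubles as a counter tape: its head stands on the bit of the
   input that belongs to column [Jv]. *)
Definition cfg (x : seq bool) (d : nat -> int) (v : cval) (pl : payload) : I -> atape A :=
  fun i => match i with
  | None => wt (bits A x) ((v Jv)%:Z - (v CW)%:Z)
  | Some (inl (inl k)) => wt (nseq (marks (size x) k) mark) (d k)
  | Some (inl (inr (X, Y))) => wt [:: mark; Some (inl false)] ((v X)%:Z - (v Y)%:Z)
  | Some (inr i) => pl i
  end.

Definition obsr (r : I -> symbol A) : obs :=
  (fun X Y => obs_bit (r (tC X Y)), obs_bit (r None)).

Lemma obsr_cfg x d v pl : obsr (heads (cfg x d v pl)) = ob x v.
Proof.
congr pair.
  apply/funext => X; apply/funext => Y.
  rewrite /heads /= /wt /cmp add0r.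
  case: eqP => [->|n1]; first by rewrite subrr.
  case: eqP => [->|n2].
    by have -> : (v Y).+1%:Z - (v Y)%:Z = 1%N by lia.
  by case E : ((v X)%:Z - (v Y)%:Z) => [[|[|n]]|n] //=; rewrite ?nth_nil //; lia.
rewrite /heads /= /wt add0r; case: ((v Jv)%:Z - (v CW)%:Z) => // n.
case: ltnP => nx; last by rewrite nth_default ?size_map.
by rewrite (nth_map false).
Qed.

Definition state2 : Type := (cval * payload)%type.

(* [P] runs in polynomial time from any configuration in which the digit tapes
   below level [k] are at rest, leaves all digit tapes as they were, and can
   realize any transition of [R]. *)
Definition okf (k : nat) (P : gmach I A) (R : seq bool -> state2 -> state2 -> Prop) : Prop :=
  exists2 t, pbound t & forall x d s s', (forall i, (i < k)%N -> d i = 0) ->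
    R x s s' -> runs P (cfg x d s.1 s.2) (cfg x d s'.1 s'.2) (t (size x)).

Lemma okf_weak k k' P (R R' : seq bool -> state2 -> state2 -> Prop) : (k <= k')%N ->
  (forall x s s', R' x s s' -> R x s s') -> okf k P R -> okf k' P R'.
Proof.
move=> kk' RR' [t pt H]; exists t => // x d s s' d0 /RR' r; apply: H r => i ik.
exact/d0/(leq_trans ik).
Qed.

Lemma okf_Seq k P Q (R R' : seq bool -> state2 -> state2 -> Prop) :
  okf k P R -> okf k Q R' ->
  okf k (Seq P Q) (fun x s s' => exists2 u, R x s u & R' x u s').
Proof.
case=> t pt H [t' pt' H']; exists (fun N => t N + t' N + 1)%N.
  by do 2?apply: pboundD => //; exact: pbound_const.
move=> x d s s' d0 [u r r']; apply: runs_Seq; first exact: (H x d s u).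
exact: (H' x d u s').
Qed.

(** * Loops over digits *)

Definition mvt (i0 : I) (m : move) : gmach I A :=
  Act (fun r i => (r i, if i == i0 then m else Stay)).

Definition sett (T : I -> atape A) (i0 : I) (a : atape A) : I -> atape A :=
  fun i => if i == i0 then a else T i.

Lemma runs_mvt T i0 m w p : T i0 = wt w p ->
  runs (mvt i0 m) T (sett T i0 (wt w (p + mvd m))) 1.
Proof.
move=> Ti0.
have -> : sett T i0 (wt w (p + mvd m)) =
    upd T (fun i => (heads T i, if i == i0 then m else Stay)); last exact: runs_Act.
apply/funext => i; rewrite /sett /upd; case: eqP => [->|_].
  by rewrite /heads Ti0 wt_move.
by rewrite awm_stay.
Qed.

Lemma sett_sett T i0 a b : sett (sett T i0 a) i0 b = sett T i0 b.
Proof. by apply/funext => i; rewrite /sett; case: eqP. Qed.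
Lemma sett_same T i0 a : sett T i0 a i0 = a.
Proof. by rewrite /sett eqxx. Qed.

(** The first step to the left leaves the blank that may follow the word; the scan then stops at the
    blank at position -1. *)
Definition Rew (i0 : I) : gmach I A :=
  Seq (mvt i0 GoLeft)
      (Seq (While (fun r => r i0 != None) (mvt i0 GoLeft)) (mvt i0 GoRight)).

Lemma runs_Rew T i0 w (p : nat) : T i0 = wt w p -> (p <= size w)%N ->
  all (fun a => a != None) w ->
  runs (Rew i0) T (sett T i0 (wt w 0)) (3 * p + 5).
Proof.
move=> Ti0 pw nw.
have r1 := @runs_mvt T i0 GoLeft w p Ti0.
pose C i := sett T i0 (wt w (p%:Z - 1 - i%:Z)).
have c0 : sett T i0 (wt w (p%:Z + mvd GoLeft)) = C 0%N by rewrite /C subr0.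
have r2 : runs (While (fun r => r i0 != None) (mvt i0 GoLeft)) (C 0%N) (C p)
    (p * (1 + 2) + 1).
  apply: runs_While.
    move=> i ip; split.
      rewrite /heads /C sett_same.
      have -> : p%:Z - 1 - i%:Z = (p - 1 - i)%N by lia.
      have ii : (p - 1 - i < size w)%N by lia.
      by rewrite wt_nat; exact: (all_nthP None nw).
    have := @runs_mvt (C i) i0 GoLeft w _ (sett_same _ _ _).
    rewrite sett_sett /C /mvd.
    by have -> : p%:Z - 1 - i%:Z + -1 = p%:Z - 1 - i.+1%:Z by lia.
  rewrite /heads /C sett_same /wt add0r.
  by have -> : p%:Z - 1 - p%:Z = Negz 0 by lia.
have r3 := @runs_mvt (C p) i0 GoRight w _ (sett_same _ _ _).
rewrite sett_sett in r3.
have e3 : p%:Z - 1 - p%:Z + mvd GoRight = 0 by rewrite /mvd; lia.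
rewrite e3 in r3; rewrite c0 in r1.
by apply: runs_le (runs_Seq r1 (runs_Seq r2 r3)) _; lia.
Qed.

Definition Dig (k : 'I_D) (P : gmach I A) : gmach I A :=
  Seq (While (fun r => r (tD k) != None) (Seq P (mvt (tD k) GoRight))) (Rew (tD k)).

Definition setd (d : nat -> int) k n : nat -> int := fun i => if i == k then n else d i.

Lemma cfg_setd x d v pl (k : 'I_D) n :
  sett (cfg x d v pl) (tD k) (wt (nseq (marks (size x) k) mark) n) =
  cfg x (setd d k n) v pl.
Proof.
apply/funext => -[[[i|[X Y]]|i]|] //=; rewrite /sett /setd /=.
have -> : (Some (inl (inl i)) == tD k) = (i == k) by [].
by case: eqP => [->|ik]; rewrite ?eqxx //; case: eqP => // /ord_inj.
Qed.

(** The head of digit tape [k] is the loop variable. The body may run while this head is away from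
    the origin, since it only asks the levels below [k] to be at rest and leaves all digit tapes as
    they were. *)
Lemma okf_Dig (k : 'I_D) P R : okf k P R ->
  okf k.+1 (Dig k P) (fun x => relpow (R x) (marks (size x) k)).
Proof.
case=> t pt H.
exists (fun N => ((N + 2) * ((t N + 1 + 1) + 2) + 1) + (3 * (N + 2) + 5) + 1)%N.
  do ?[apply: pboundD | apply: pboundM | exact: pbound_const | exact: pt | exact: pbound_id].
move=> x d s s' d0 /relpow_chain[C [C0 Cn HC]].
set n := marks (size x) k in Cn HC *.
have nN : (n <= size x + 2)%N by rewrite /n /marks; case: ifP => // _; rewrite leq_addr.
pose G i := cfg x (setd d k i%:Z) (C i).1 (C i).2.
have dk : setd d k 0 = d.
  apply/funext => i; rewrite /setd; case: eqP => [->|//]; by rewrite d0.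
have Gk i : G i (tD k) = wt (nseq n mark) i.
  by rewrite /G /= /setd eqxx.
have r1 : runs (While (fun r => r (tD k) != None) (Seq P (mvt (tD k) GoRight)))
    (G 0%N) (G n) (n * ((t (size x) + 1 + 1) + 2) + 1).
  apply: runs_While => [i ii|].
    split; first by rewrite /heads Gk wt_nat nth_nseq ii.
    apply: runs_Seq.
      apply: (H x (setd d k i%:Z) (C i) (C i.+1)); last exact: HC.
      by move=> j jk; rewrite /setd ltn_eqF // d0 // ltnW.
    rewrite /G -[setd d k i.+1%:Z](_ : setd (setd d k i%:Z) k i.+1%:Z = _).
      rewrite -(cfg_setd x (setd d k i%:Z)) -/n.
      have -> : i.+1%:Z = i%:Z + mvd GoRight by rewrite /mvd; lia.
      by apply: runs_mvt; rewrite /= /setd eqxx.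
    by apply/funext => j; rewrite /setd; case: eqP.
  by rewrite /heads Gk wt_nat nth_nseq ltnn.
have := @runs_Rew (G n) (tD k) (nseq n mark) n (Gk n).
rewrite size_nseq all_nseq orbT => /(_ (leqnn _) isT).
rewrite /G {2}/n cfg_setd.
have -> : setd (setd d k n%:Z) k 0 = d.
  by rewrite -[RHS]dk; apply/funext => j; rewrite /setd; case: eqP.
move=> r2; move: r1; rewrite /G C0 dk Cn => r1; rewrite Cn in r2.
apply: runs_le (runs_Seq r1 r2) _.
by rewrite !leq_add2r; apply: leq_add; nia.
Qed.

(** The fallback for [k] out of range does not occur under the hypothesis [k + h <= D] of
    [okf_For]. *)
Definition DigN (k : nat) (P : gmach I A) : gmach I A :=
  if insub k is Some k' then Dig k' P else P.

Fixpoint For (k h : nat) (P : gmach I A) : gmach I A :=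
  if h is h'.+1 then DigN (k + h') (For k h' P) else P.

Lemma okf_For k h P R (f : nat -> nat) : (k + h <= D)%N ->
  (forall N i, (k <= i < k + h)%N -> marks N i = f N) -> okf k P R ->
  okf (k + h) (For k h P) (fun x => relpow (R x) (f (size x) ^ h)).
Proof.
elim: h => [|h IH] kh m HP /=.
  rewrite addn0; apply: okf_weak HP => // x s s'.
  by rewrite /= => -[u H <-].
have kh1 : (k + h <= D)%N by lia.
have m1 N i : (k <= i < k + h)%N -> marks N i = f N by move=> ii; apply: m; lia.
have H' := IH kh1 m1 HP.
have kh' : (k + h < D)%N by lia.
rewrite /DigN insubT addnS.
apply: (okf_weak (leqnn _) _ (okf_Dig (k := Ordinal kh') H')).
by move=> x s s' /=; rewrite expnS m; [exact: relpowM | lia].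
Qed.

(** * Counters *)

(* The head of the tape of (Y, Z) follows Y - Z. *)
Definition sg (up p q : bool) : move :=
  if p == q then Stay else if p == up then GoRight else GoLeft.

Definition Inc (up : bool) (X : Ctr) : gmach I A :=
  Act (fun r i => (r i, match i with
    | None => sg up (Jv == X) (CW == X)
    | Some (inl (inr (Y, Z))) => sg up (Y == X) (Z == X)
    | _ => Stay end)).

Lemma sgE (up : bool) v X Y Z n : (if up then n = (v X).+1 else v X = n.+1) ->
  (v Y)%:Z - (v Z)%:Z + mvd (sg up (Y == X) (Z == X)) =
  (setv v X n Y)%:Z - (setv v X n Z)%:Z.
Proof.
rewrite /sg /setv; case: (altP (Y =P X)) => [->|_]; case: (altP (Z =P X)) => [->|_];
  case: up => nv /=; rewrite ?nv; lia.
Qed.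

Lemma runs_Inc up X x d v pl n : (if up then n = (v X).+1 else v X = n.+1) ->
  runs (Inc up X) (cfg x d v pl) (cfg x d (setv v X n) pl) 1.
Proof.
move=> nv; set c := cfg x d v pl; rewrite /Inc; set f := (X in Act X).
have -> : cfg x d (setv v X n) pl = upd c (f (heads c)); last exact: runs_Act.
apply/funext => -[[[k|[Y Z]]|i]|]; rewrite /upd /f /heads /c /=.
- by rewrite wt_move addr0.
- by rewrite wt_move (sgE _ _ nv).
- by rewrite awm_stay.
- by rewrite wt_move (sgE _ _ nv).
Qed.

Lemma okf_Inc up X : okf 0 (Inc up X) (fun x s s' =>
  [/\ s'.2 = s.2, s'.1 = setv s.1 X (s'.1 X) &
   if up then s'.1 X = (s.1 X).+1 else s.1 X = (s'.1 X).+1]).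
Proof.
exists (fun=> 1%N) => [|x d [v pl] [v' pl'] _ /= [-> e H]]; first exact: pbound_const.
by rewrite e; exact: runs_Inc.
Qed.

(** * Programs acting on the payload *)

Section Payload.
Variables (S : Type) (pt : seq bool -> S -> payload).

Definition zeros (Xs : seq Ctr) (v : cval) : Prop := forall X, X \in Xs -> v X = 0%N.

(** Functional specification: [pt] represents an abstract state by the payload tapes, [g] transforms
    it, and the counters are restored. The counters in [Xs] are loop variables, hence zero on
    entry. *)
Definition ok (k : nat) (Xs : seq Ctr) (P : gmach I A)
    (g : seq bool -> cval -> S -> S) : Prop :=
  okf k P (fun x s s' => exists v u, [/\ zeros Xs v, s = (v, pt x u) &
    s' = (v, pt x (g x v u))]).

Lemma ok_weak k k' (Xs Xs' : seq Ctr) P g : (k <= k')%N -> {subset Xs <= Xs'} ->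
  ok k Xs P g -> ok k' Xs' P g.
Proof.
move=> kk' sX; apply: okf_weak => // x s s' [v [u [z e e']]].
by exists v, u; split=> // X /sX; exact: z.
Qed.

Lemma ok_ext k Xs P g g' : (forall x v u, zeros Xs v -> g x v u = g' x v u) ->
  ok k Xs P g -> ok k Xs P g'.
Proof.
move=> gg'; apply: okf_weak => // x s s' [v [u [z e e']]].
by exists v, u; split=> //; rewrite gg'.
Qed.

Lemma ok_Seq k Xs P Q g h : ok k Xs P g -> ok k Xs Q h ->
  ok k Xs (Seq P Q) (fun x v u => h x v (g x v u)).
Proof.
move=> H1 H2; apply: okf_weak (okf_Seq H1 H2) => // x s s' [v [u [z -> ->]]].
by exists (v, pt x (g x v u)); [exists v, u | exists v, (g x v u)].
Qed.

Definition PAct (f : obs -> (payload_tape -> symbol A) -> payload_tape -> symbol A * move) : gmach I A :=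
  Act (fun r i => if i is Some (inr j) then f (obsr r) (fun j => r (tP j)) j
                  else keep r i).

Lemma ok_PAct k Xs f g :
  (forall x v u i, awm (pt x u i) (f (ob x v) (fun j => pt x u j 0) i) =
    pt x (g x v u) i) ->
  ok k Xs (PAct f) g.
Proof.
move=> H; exists (fun=> 1%N); first exact: pbound_const.
move=> x d _ _ _ [v [u [_ -> ->]]] /=.
rewrite /PAct; set c := cfg x d v _; set F := (X in Act X).
have -> : cfg x d v (pt x (g x v u)) = upd c (F (heads c)); last exact: runs_Act.
apply/funext => -[[[k'|[Y Z]]|i]|]; rewrite /upd /F.
- by rewrite awm_stay.
- by rewrite awm_stay.
- by rewrite /c obsr_cfg /= -H.
- by rewrite awm_stay.
Qed.

Definition Skip : gmach I A := Act (@keep I A).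

Lemma ok_Skip k Xs : ok k Xs Skip (fun _ _ u => u).
Proof.
exists (fun=> 1%N); first exact: pbound_const.
move=> x d _ _ _ [v [u [_ -> ->]]] /=.
by rewrite -{2}(upd_keep (cfg _ _ _ _)); exact: runs_Act.
Qed.

Definition Fin (F : Type) (fs : seq F) (P : F -> gmach I A) : gmach I A :=
  foldr (fun f M => Seq (P f) M) Skip fs.

Lemma ok_Fin (F : Type) (fs : seq F) P k Xs (g : F -> seq bool -> cval -> S -> S) :
  (forall f, ok k Xs (P f) (g f)) ->
  ok k Xs (Fin fs P) (fun x v u => foldl (fun u f => g f x v u) u fs).
Proof.
move=> H; elim: fs => [|f fs IH] /=; first exact: ok_Skip.
exact: (ok_Seq (H f) IH).
Qed.

Definition LoopC (X : Ctr) (k h : nat) (P : gmach I A) : gmach I A :=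
  Seq (For k h (Seq P (Inc true X))) (For k h (Inc false X)).

(** The first loop runs the body at the values 0, 1, and so on of [X], ending with [X] at the number
    of rounds; the second one decrements it back to 0. *)
Lemma ok_LoopC X k h Xs P g : (k + h <= D1)%N -> (D1 <= D)%N -> X \notin Xs ->
  ok k Xs P g ->
  ok (k + h) (X :: Xs) (LoopC X k h P) (fun x v u =>
    foldl (fun u n => g x (setv v X n) u) u (iota 0 ((size x + 2) ^ h))).
Proof.
move=> kh DD XXs HP.
have kD : (k + h <= D)%N by lia.
have m N i : (k <= i < k + h)%N -> marks N i = (N + 2)%N.
  by move=> /andP[_ ii]; rewrite /marks (leq_trans ii kh).
have H1 := okf_For kD m (okf_Seq HP (okf_weak (leq0n k) (fun _ _ _ h => h) (okf_Inc true X))).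
have H2 := okf_For kD m (okf_weak (leq0n k) (fun _ _ _ h => h) (okf_Inc false X)).
apply: okf_weak (okf_Seq H1 H2) => // x s s' [v [u [z -> ->]]].
have v0 : v X = 0%N by apply: z; rewrite mem_head.
set n := (_ ^ h)%N; pose G := fun u n => g x (setv v X n) u.
rewrite -/G.
exists (setv v X n, pt x (foldl G u (iota 0 n))).
  apply/relpow_chain.
  exists (fun i => (setv v X i, pt x (foldl G u (iota 0 i)))); split=> //=.
    by rewrite -v0 setv_id.
  move=> i ii; exists (setv v X i, pt x (foldl G u (iota 0 i.+1))).
    exists (setv v X i), (foldl G u (iota 0 i)); split=> //.
      move=> Y YXs; rewrite /setv; case: eqP => [YX|_]; first by rewrite -YX YXs in XXs.
      by apply: z; rewrite inE YXs orbT.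
    by rewrite -addn1 iotaD foldl_cat.
  by rewrite /= !setv_same setv_setv.
apply/relpow_chain.
exists (fun i => (setv v X (n - i), pt x (foldl G u (iota 0 n)))); split=> //=.
- by rewrite subn0.
- by rewrite subnn -v0 setv_id.
- move=> i ii; rewrite !setv_same setv_setv; split=> //; lia.
Qed.

End Payload.
Arguments Skip : clear implicits.

(** * Enumeration of the vertices *)

Section Vertices.
Variables (G Q : finType) (cT cJ h cm : nat).

(** [None] is the root, [inl g] marks the chain of a set with value [g], and [inr q] the copies of
    an element. The three numbers are the row, the column, and the place in the chain or the index
    of the copy. *)
Definition tag : Type := option (G + Q)%type.
Definition label : Type := (tag * (nat * nat * nat))%type.

Definition block (b : nat) (f : tag) (hz : nat) : seq label :=
  flatten [seq flatten [seq [seq (f, (t, j, z)) | z <- iota 0 (b ^ hz)]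
    | j <- iota 0 (b ^ cJ)] | t <- iota 0 (b ^ cT)].

Definition labels (b : nat) : seq label :=
  (None, (0, 0, 0)%N) ::
  flatten [seq block b (Some (inl g)) h | g <- enum G] ++
  flatten [seq block b (Some (inr q)) cm | q <- enum Q].

Definition setl (X Y Z : Ctr) (v : cval) (l : label) : cval :=
  let: (t, j, z) := l.2 in setv (setv (setv v X t) Y j) Z z.

Lemma foldl_flatten (T U : Type) (f : U -> T -> U) u (ss : seq (seq T)) :
  foldl f u (flatten ss) = foldl (foldl f) u ss.
Proof. by elim: ss u => //= s ss IH u; rewrite foldl_cat IH. Qed.

Lemma foldl_map (T T' U : Type) (f : U -> T -> U) (F : T' -> T) u s :
  foldl f u (map F s) = foldl (fun u x => f u (F x)) u s.
Proof. by elim: s u => //= x s IH u. Qed.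

Lemma eq_foldl (T U : Type) (f g : U -> T -> U) u s :
  (forall u x, f u x = g u x) -> foldl f u s = foldl g u s.
Proof. by move=> fg; elim: s u => //= x s IH u; rewrite fg. Qed.

Variables (S : Type) (pt : seq bool -> S -> payload).

(** The middle loop starts at level [k + cm] whatever [hz] is, so that chains and elements use the
    same digit tapes. *)
Definition Block (k hz : nat) (X Y Z : Ctr) (P : gmach I A) : gmach I A :=
  LoopC X (k + cm + cJ) cT (LoopC Y (k + cm) cJ (LoopC Z k hz P)).

Definition ForV (k : nat) (X Y Z : Ctr) (P : tag -> gmach I A) : gmach I A :=
  Seq (P None)
   (Seq (Fin (enum G) (fun g => Block k h X Y Z (P (Some (inl g)))))
        (Fin (enum Q) (fun q => Block k cm X Y Z (P (Some (inr q)))))).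

Lemma ok_Block k hz X Y Z Xs f P g : (hz <= cm)%N ->
  (k + cm + cJ + cT <= D1)%N -> (D1 <= D)%N -> uniq [:: X, Y, Z & Xs] ->
  ok pt k Xs P g ->
  ok pt (k + cm + cJ + cT) [:: X, Y, Z & Xs] (Block k hz X Y Z P) (fun x v u =>
    foldl (fun u l => g x (setl X Y Z v l) u) u (block (size x + 2) f hz)).
Proof.
move=> hc kD DD /= /and4P[X1 Y1 Z1 _] HP.
have H1 := ok_LoopC (h := hz) (_ : (k + hz <= D1)%N) DD Z1 HP.
have {}H1 := ok_weak (_ : (k + hz <= k + cm)%N) (fun _ h => h) (H1 ltac:(lia)).
have H2 := ok_LoopC (h := cJ) (_ : (k + cm + cJ <= D1)%N) DD Y1 (H1 ltac:(lia)).
have H3 := ok_LoopC kD DD X1 (H2 ltac:(lia)).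
apply: ok_ext H3 => x v u _.
rewrite /block foldl_flatten foldl_map; apply: eq_foldl => {}u t.
rewrite foldl_flatten foldl_map; apply: eq_foldl => {}u j.
by rewrite foldl_map.
Qed.

Lemma ok_ForV k X Y Z Xs P (g : tag -> seq bool -> cval -> S -> S) : (h <= cm)%N ->
  (k + cm + cJ + cT <= D1)%N -> (D1 <= D)%N -> uniq [:: X, Y, Z & Xs] ->
  (forall f, ok pt k Xs (P f) (g f)) ->
  ok pt (k + cm + cJ + cT) [:: X, Y, Z & Xs] (ForV k X Y Z P) (fun x v u =>
    foldl (fun u l => g l.1 x (setl X Y Z v l) u) u (labels (size x + 2))).
Proof.
move=> hc kD DD U HP.
have H0 : ok pt (k + cm + cJ + cT) [:: X, Y, Z & Xs] (P None) (g None).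
  apply: ok_weak (HP None); first by lia.
  by move=> W WXs; rewrite !inE WXs !orbT.
have H1 := ok_Fin (enum G) (fun a =>
  ok_Block (Some (inl a)) hc kD DD U (HP (Some (inl a)))).
have H2 := ok_Fin (enum Q) (fun a =>
  ok_Block (Some (inr a)) (leqnn cm) kD DD U (HP (Some (inr a)))).
apply: ok_ext (ok_Seq H0 (ok_Seq H1 H2)) => x v u z.
rewrite /labels /= foldl_cat !foldl_flatten !foldl_map.
(* The program for the root runs outside all loops; the counters are zero then, as the triple of the
   root demands. *)
have -> : setl X Y Z v (None, (0, 0, 0)%N) = v.
  have zz W : W \in [:: X, Y, Z & Xs] -> setv v W 0 = v.
    by move=> /z {1}<-; rewrite setv_id.
  by rewrite /setl /= !zz // !inE eqxx ?orbT.
have E f hz w : foldl (fun u l => g f x (setl X Y Z v l) u) w (block (size x + 2) f hz) =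
    foldl (fun u l => g l.1 x (setl X Y Z v l) u) w (block (size x + 2) f hz).
  rewrite /block !foldl_flatten !foldl_map; apply: eq_foldl => {}w t.
  rewrite !foldl_flatten !foldl_map; apply: eq_foldl => {}w j.
  by rewrite !foldl_map.
under [in LHS]eq_foldl do rewrite E.
by rewrite (eq_foldl (g := fun u0 f => foldl (fun u l => g l.1 x (setl X Y Z v l) u) u0 (block (size x + 2) (Some (inl f)) h))).
Qed.

End Vertices.
End Programs.

(** * Folds, sizes and values of polynomials *)

Lemma foldl_rcons (T U : Type) (F : T -> U) w s :
  foldl (fun w x => rcons w (F x)) w s = w ++ map F s.
Proof.
elim: s w => [|x s IH] w /=; first by rewrite cats0.
by rewrite IH cat_rcons.
Qed.

Lemma foldl_cats (T U : Type) (F : T -> seq U) w s :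
  foldl (fun w x => w ++ F x) w s = w ++ flatten (map F s).
Proof.
elim: s w => [|x s IH] w /=; first by rewrite cats0.
by rewrite IH catA.
Qed.

Lemma size_flatten_map (T U : Type) (F : T -> seq U) s m :
  (forall a, size (F a) = m) -> size (flatten (map F s)) = (size s * m)%N.
Proof. by move=> Fm; elim: s => //= a s IH; rewrite size_cat Fm IH mulSn. Qed.

Lemma foldl_scan (T : Type) (P : int -> T -> bool) (x0 : T) i f r (s : seq T) :
  foldl (fun (u : int * bool * bool) x =>
    (u.1.1 + 1, u.1.2 || P u.1.1 x, u.2)) (i, f, r) s =
  (i + (size s)%:Z, f || has (fun k => P (i + k%:Z) (nth x0 s k)) (iota 0 (size s)), r).
Proof.
elim: s i f => [|x s IH] i f /=; first by rewrite addr0 orbF.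
rewrite IH addr0 orbA; congr (_, _ || _, _); first by lia.
rewrite (iotaDl 1 0) has_map; apply: eq_has => k /=.
by congr (P _ _); lia.
Qed.

Lemma horner_nat (q : {poly nat}) (N : nat) :
  q.[N] = (\sum_(i <- iota 0 (size q)) (q`_i)%R * N ^ i)%N.
Proof.
have -> : (\sum_(i <- iota 0 (size q)) (q`_i)%R * N ^ i =
           \sum_(i < size q) (q`_i)%R * N ^ i)%N.
  by rewrite -(big_mkord xpredT (fun i => (q`_i)%R * N ^ i)%N) /index_iota subn0.
rewrite horner_coef; exact: eq_bigr.
Qed.

(** * A decision machine built around the approximation algorithm *)

Section Decider.
Variables (B : machine) (G Q : finType) (cT cJ cC h cm : nat) (q : {poly nat}).
Hypothesis hcm : (h <= cm)%N.
Hypothesis cTJ : (cC <= cJ)%N.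

(** One enumeration of the vertices takes [depth] digit tapes, two nested ones take [D1], and
    [size q] more are there for the powers of [N] in [q]. *)
Let depth : nat := (0 + cm + cJ + cT)%N.
Let D1 : nat := (depth + cm + cJ + cT)%N.
Let D : nat := (D1 + size q)%N.
Let DD : (D1 <= D)%N. Proof. exact: leq_addr. Qed.

Local Notation I := (tapes B D).
Local Notation A := (alphabet B).
Local Notation Pl := (payload_tape B).
Local Notation mark := (mark B).
Local Notation Inc := (@Inc B D).
Local Notation tD := (@tD B D).
Local Notation tOut := (tOut B).
Local Notation tFlag := (tFlag B).
Local Notation tRes := (tRes B).
Local Notation cfg := (@cfg B D1 D).
Local Notation okf := (@okf B D1 D).
Local Notation ok := (@ok B D1 D).
Local Notation labels := (labels G Q cT cJ h cm).
Local Notation tag := (tag G Q).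
Local Notation label := (label G Q).

(** * Setting up the counters *)

Definition rt (P : gmach I A) (F F' : seq bool -> I -> atape A) : Prop :=
  exists2 t, pbound t & forall x, runs P (F x) (F' x) (t (size x)).

Lemma rt_Seq P P' F1 F2 F3 : rt P F1 F2 -> rt P' F2 F3 -> rt (Seq P P') F1 F3.
Proof.
case=> t pt H [t' pt' H']; exists (fun N => t N + t' N + 1)%N.
  by do 2?apply: pboundD => //; exact: pbound_const.
by move=> x; apply: runs_Seq (H x) (H' x).
Qed.

Lemma okf_rt k P R s s' : okf k P R -> (forall x, R x (s x) (s' x)) ->
  rt P (fun x => cfg x (fun=> 0) (s x).1 (s x).2) (fun x => cfg x (fun=> 0) (s' x).1 (s' x).2).
Proof. by case=> t pt H Rs; exists t => // x; apply: H. Qed.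

Definition oka (X : Ctr) (P : gmach I A) (f : nat -> nat) : Prop :=
  okf D P (fun x s s' => s' = (setv s.1 X (s.1 X + f (size x))%N, s.2)).

Lemma oka_Inc k X : okf k (Inc true X)
  (fun x s s' => s' = (setv s.1 X (s.1 X + 1)%N, s.2)).
Proof.
apply: okf_weak (@okf_Inc B D1 D true X) => // x s _ -> /=.
by split=> //; rewrite ?setv_same ?addn1.
Qed.

Lemma oka_For X k n (f : nat -> nat) : (k + n <= D)%N ->
  (forall N i, (k <= i < k + n)%N -> marks D1 N i = f N) ->
  oka X (For k n (Inc true X)) (fun N => f N ^ n)%N.
Proof.
move=> kD m; apply: okf_weak (okf_For kD m (oka_Inc k X)) => // x s s' ->.
apply/relpow_chain; exists (fun i => (setv s.1 X (s.1 X + i)%N, s.2)); split=> //.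
  by case: s => v pl /=; rewrite addn0 setv_id.
by move=> i _ /=; rewrite setv_same setv_setv addn1 addnS.
Qed.

Lemma oka_Seq X P P' f f' : oka X P f -> oka X P' f' ->
  oka X (Seq P P') (fun N => f N + f' N)%N.
Proof.
move=> H H'; apply: okf_weak (okf_Seq H H') => // x s s' ->.
by eexists; first reflexivity; rewrite /= setv_same setv_setv addnA.
Qed.

Lemma oka_Fin (F : eqType) X (fs : seq F) P (f : F -> nat -> nat) :
  (forall a, a \in fs -> oka X (P a) (f a)) ->
  oka X (Fin fs P) (fun N => \sum_(a <- fs) f a N)%N.
Proof.
elim: fs => [|a fs IH] H /=.
  exists (fun=> 1%N); first exact: pbound_const.
  move=> x d s s' _ ->; rewrite big_nil addn0 /= setv_id.
  by rewrite -{2}(upd_keep (cfg _ _ _ _)); exact: runs_Act.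
have Ha := H a (mem_head _ _).
have Hs : oka X (Fin fs P) (fun N => \sum_(a <- fs) f a N)%N.
  by apply: IH => b bfs; apply: H; rewrite inE bfs orbT.
apply: okf_weak (oka_Seq Ha Hs) => // x s s' ->.
by rewrite big_cons.
Qed.

(** A coefficient is unrolled into that many copies of a loop nest; its loops use the tapes from
    [D1] on, whose [N] marks give [N ^ i] rounds. *)
Definition AddPoly (X : Ctr) : gmach I A :=
  Fin (iota 0 (size q)) (fun i =>
    Fin (iota 0 (q`_i)%R) (fun _ => For D1 i (Inc true X))).

Lemma oka_AddPoly X : oka X (AddPoly X) (fun N => q.[N])%N.
Proof.
have H : oka X (AddPoly X) (fun N => \sum_(i <- iota 0 (size q))
    \sum_(a <- iota 0 (q`_i)%R) N ^ i)%N.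
  apply: oka_Fin => i; rewrite mem_iota add0n => /andP[_ ii].
  apply: (@oka_Fin _ X _ (fun=> For D1 i (Inc true X)) (fun _ N => N ^ i)%N) => a _.
  apply: (@oka_For X D1 i id); first by rewrite leq_add2l ltnW.
  by move=> N k /andP[kD _]; rewrite /marks ltnNge kD.
apply: okf_weak H => // x s s' ->; congr (setv _ _ (_ + _), _).
rewrite horner_nat; apply: eq_bigr => i _.
by rewrite big_const_seq count_predT size_iota iter_addn addn0 mulnC.
Qed.

Definition constants (N : nat) : cval := (fun X =>
  if X == CT then (N + 2) ^ cT else if X == CJ then (N + 2) ^ cJ else
  if X == CW then (N + 2) ^ cC else if X == CL then (N + 2) ^ h else
  if X == CQ then (N + 2) ^ cC + q.[N]%R else 0)%N.

Definition AddPow (X : Ctr) (c : nat) : gmach I A := For 0 c (Inc true X).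

Lemma oka_AddPow X c : (c <= D1)%N -> oka X (AddPow X c) (fun N => (N + 2) ^ c)%N.
Proof.
move=> cD; apply: (@oka_For X 0 c (fun N => (N + 2)%N)); first by rewrite add0n; lia.
by move=> N i /andP[_ ii]; rewrite /marks (leq_trans ii).
Qed.

Definition Consts : gmach I A :=
  Seq (AddPow CT cT) (Seq (AddPow CJ cJ) (Seq (AddPow CW cC) (Seq (AddPow CL h)
    (Seq (AddPow CQ cC) (AddPoly CQ))))).

Lemma rt_Consts (pl : seq bool -> payload B) : rt Consts
  (fun x => cfg x (fun=> 0) (fun=> 0%N) (pl x))
  (fun x => cfg x (fun=> 0) (constants (size x)) (pl x)).
Proof.
have l1 : (cT <= D1)%N by rewrite /D1 /depth; lia.
have l2 : (cJ <= D1)%N by rewrite /D1 /depth; lia.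
have l3 : (cC <= D1)%N by lia.
have l4 : (h <= D1)%N by rewrite /D1 /depth; lia.
have H := okf_Seq (oka_AddPow CT l1) (okf_Seq (oka_AddPow CJ l2) (okf_Seq (oka_AddPow CW l3)
  (okf_Seq (oka_AddPow CL l4) (okf_Seq (oka_AddPow CQ l3) (oka_AddPoly CQ))))).
apply: (okf_rt (s := fun x => (fun=> 0%N, pl x)) (s' := fun x => (constants (size x), pl x)) H).
move=> x; do 5!(eexists; first reflexivity).
congr pair; apply/funext => X; rewrite /constants /setv /=.
by case: X => -[|[|[|[|[|[|[|[|[|[|[|[|]]]]]]]]]]]].
Qed.

(** * Initialization of the tapes *)

Definition input_only (x : seq bool) : I -> atape A :=
  fun i => wt (if i is None then bits A x else [::]) 0.

Definition blank_payload : payload B := fun i => wt (if i is inr _ then [:: mark] else [::]) 0.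

(** The tapes once [n] input bits have been turned into marks on all digit tapes and [m] further
    marks have been appended to the first [D1] of them. *)
Definition copied (x : seq bool) (n m : nat) : I -> atape A := fun i => match i with
  | None => wt (bits A x) n
  | Some (inl (inl k)) => let j := if (k < D1)%N then (n + m)%N else n in
      wt (nseq j mark) j
  | Some (inl (inr _)) => wt [:: mark; Some (inl false)] 0
  | Some (inr i) => blank_payload i
  end.

Definition Marks1 : gmach I A := Act (fun (r : I -> symbol A) (i : I) => match i with
  | Some (inl (inr _)) => (mark, GoRight)
  | Some (inr (inr _)) => (mark, Stay)
  | _ => keep r i end).

Definition Marks2 : gmach I A := Act (fun (r : I -> symbol A) (i : I) => match i with
  | Some (inl (inr _)) => (Some (inl false), GoLeft)
  | _ => keep r i end).

Definition Copy : gmach I A := While (fun r => r None != None)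
  (Act (fun (r : I -> symbol A) (i : I) => match i with
    | None => (r i, GoRight)
    | Some (inl (inl _)) => (mark, GoRight)
    | _ => keep r i end)).

Definition Extend : gmach I A := Act (fun (r : I -> symbol A) (i : I) => match i with
    | Some (inl (inl k)) => if (k < D1)%N then (mark, GoRight) else keep r i
    | _ => keep r i end).

Definition RewAll : gmach I A :=
  Seq (Rew None) (foldr (fun k M => Seq (Rew (tD k)) M) (Act (@keep I A)) (enum 'I_D)).

Definition Setup : gmach I A :=
  Seq Marks1 (Seq Marks2 (Seq Copy (Seq Extend (Seq Extend RewAll)))).

Lemma wt_nseq_append n :
  awm (wt (nseq n mark) n) (mark, GoRight) = wt (nseq n.+1 mark) n.+1.
Proof.
have -> : nseq n.+1 mark = rcons (nseq n mark) mark by elim: n => //= n {1}->.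
by have := wt_append (nseq n mark) mark; rewrite size_rcons !size_nseq.
Qed.

Lemma rt_Setup : rt Setup input_only (fun x => cfg x (fun=> 0) (fun=> 0%N) blank_payload).
Proof.
pose U x : I -> atape A := fun i => match i with
  | Some (inl (inr _)) => wt [:: mark] 1
  | Some (inr i) => blank_payload i
  | _ => input_only x i end.
have pb1 : pbound (fun=> 1%N) by exact: pbound_const.
have S1 : rt Marks1 input_only U.
  exists (fun=> 1%N) => // x; rewrite /Marks1; set f := (X in Act X).
  have -> : U x = upd (input_only x) (f (heads (input_only x))); last exact: runs_Act.
  apply/funext => -[[[k|YZ]|[i|i]]|]; rewrite /upd /f /U /input_only /heads ?awm_stay //=.
    by have := wt_append [::] mark.
  by rewrite /blank_payload; apply/funext => z; rewrite /awm addr0 (@wt_put _ [::] 0).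
have S2 : rt Marks2 U (fun x => copied x 0 0).
  exists (fun=> 1%N) => // x.
  rewrite /Marks2; set f := (X in Act X).
  have -> : copied x 0 0 = upd (U x) (f (heads (U x))); last exact: runs_Act.
  apply/funext => -[[[k|YZ]|[i|i]]|]; rewrite /upd /f /U /copied /input_only /heads ?awm_stay ?if_same //=.
  apply/funext => z; rewrite /awm /= (@wt_put _ [:: mark] 1) //=.
  by rewrite /wt; have -> : z + -1 + 1 = z + 0 by lia.
have S3 : rt Copy (fun x => copied x 0 0) (fun x => copied x (size x) 0).
  exists (fun N => N * (1 + 2) + 1)%N.
    by apply: pboundD => //; apply: pboundM; [exact: pbound_id | exact: pbound_const].
  move=> x; apply: (@runs_While _ _ _ _ (fun n => copied x n 0)) => [n nx|].
    split; first by rewrite /heads /copied wt_nat (nth_map false).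
    set f := (X in Act X).
    have -> : copied x n.+1 0 = upd (copied x n 0) (f (heads (copied x n 0))); last exact: runs_Act.
    apply/funext => -[[[k|YZ]|i]|]; rewrite /upd /f /copied /heads ?awm_stay /= ?addn0 ?if_same //.
      exact/esym/wt_nseq_append.
    by rewrite wt_move /mvd; congr wt; lia.
  by rewrite /heads /copied wt_nat nth_default // size_map.
have S4 m : rt Extend (fun x => copied x (size x) m) (fun x => copied x (size x) m.+1).
  exists (fun=> 1%N) => // x; rewrite /Extend; set f := (X in Act X).
  have -> : copied x (size x) m.+1 = upd (copied x (size x) m) (f (heads (copied x (size x) m)));
    last exact: runs_Act.
  apply/funext => -[[[k|YZ]|i]|]; rewrite /upd /f /copied /heads ?awm_stay //.
  rewrite /keep /=; case: ifP => kD; rewrite /= ?kD; last exact/esym/awm_stay.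
  rewrite addnS; exact/esym/wt_nseq_append.
have S5 : rt RewAll (fun x => copied x (size x) 2) (fun x => cfg x (fun=> 0) (fun=> 0%N) blank_payload).
  exists (fun N => (3 * N + 5) + (D * (3 * (N + 2) + 5).+1 + 1) + 1)%N.
    apply: (@pbound_le _ (fun N => (3 * N + 5) + (D * (3 * (N + 2) + 6) + 1) + 1)%N).
      by move=> N; lia.
    by do ?[apply: pboundD | apply: pboundM | exact: pbound_const | exact: pbound_id].
  move=> x; set TT := copied x (size x) 2.
  pose C (m : nat) : I -> atape A := fun i => match i with
    | None => wt (bits A x) 0
    | Some (inl (inl k)) => if (k < m)%N then wt (nseq (marks D1 (size x) k) mark) 0
                            else TT i
    | _ => TT i end.
  apply: (@runs_Seq _ _ _ _ _ (C 0%N)).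
    have := @runs_Rew B D TT None (bits A x) (size x) erefl.
    rewrite size_map => /(_ (leqnn _)).
    have -> : sett TT None (wt (bits A x) 0) = C 0%N by apply/funext => -[[[k|YZ]|i]|].
    by apply; apply/allP => a /mapP[b _ ->].
  have -> : cfg x (fun=> 0) (fun=> 0%N) blank_payload = C (size (enum 'I_D)).
    by apply/funext => -[[[k|[Y Z]]|i]|] //=; rewrite size_enum_ord ltn_ord.
  apply: (@runs_le _ _ _ _ _ (size (enum 'I_D) * (3 * (size x + 2) + 5).+1 + 1));
    last by rewrite size_enum_ord.
  apply: (runs_Seqs (P := fun k => Rew (tD k)) (C := C)).
  move=> m k0; rewrite size_enum_ord => mD.
  set k := nth k0 _ _; have km : k = m :> nat by rewrite /k nth_enum_ord.
  set w := nseq (marks D1 (size x) k) mark.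
  have Ck : C m (tD k) = wt w (size w).
    rewrite /C /= km ltnn /w size_nseq /marks km /=.
    by case: ifP => _; rewrite ?addn2.
  have -> : C m.+1 = sett (C m) (tD k) (wt w 0).
    apply/funext => -[[[k'|YZ]|i]|] //; rewrite /sett /=.
    have -> : (Some (inl (inl k')) == tD k) = (k' == k) by [].
    case: eqP => [->|kk']; first by rewrite /w km ltnSn.
    rewrite ltnS leq_eqVlt; case: eqP => //= e; case: kk'; apply: ord_inj.
    by rewrite e km.
  have wN : (size w <= size x + 2)%N.
    by rewrite size_nseq /marks; case: ifP; rewrite ?leq_addr.
  apply: runs_le (runs_Rew Ck (leqnn _) _) _; last by lia.
  by rewrite all_nseq orbT.
exact: rt_Seq S1 (rt_Seq S2 (rt_Seq S3 (rt_Seq (S4 0%N) (rt_Seq (S4 1%N) S5)))).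
Qed.

(** * Writing the instance *)

(** Tests for adjacency and nearness of two vertices. They see only the observation and the two
    tags, which the finite control knows. *)
Variables eE nE : obs -> tag -> tag -> bool.

Definition ptE (x : seq bool) (w : seq bool) : payload B :=
  fun i => if i == tOut then wt (bits A w) (size w) else blank_payload i.

Definition Emit (f : obs -> bool) : gmach I A :=
  @PAct B D (fun o r i => if i == tOut then (Some (inl (f o)), GoRight) else (r i, Stay)).

Lemma ok_Emit k Xs f : ok ptE k Xs (Emit f) (fun x v w => rcons w (f (ob x v))).
Proof.
apply: ok_PAct => x v w i; rewrite /ptE; case: eqP => _; last exact: awm_stay.
by have := wt_append (bits A w) (Some (inl (f (ob x v)))); rewrite /bits !size_rcons size_map map_rcons.
Qed.

Definition pair_vals (x : seq bool) (u v : label) : cval :=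
  setl Tv Jv Zv (setl Tu Ju Zu (constants (size x)) u) v.

Definition inst (x : seq bool) : seq bool :=
  let b := (size x + 2)%N in
  nseq (size (labels b)) true ++ false ::
  nseq (b ^ cT * b ^ cJ).+1 true ++ false ::
  [seq eE (ob x (pair_vals x u v)) u.1 v.1 | u <- labels b, v <- labels b].

Local Notation ForV := (@ForV B D G Q cT cJ h cm).

Definition Write : gmach I A :=
  Seq (ForV 0 Tu Ju Zu (fun _ => Emit (fun _ => true)))
  (Seq (Emit (fun _ => false))
  (Seq (Emit (fun _ => true))
  (Seq (LoopC Tu (0 + cJ) cT (LoopC Ju 0 cJ (Emit (fun _ => true))))
  (Seq (Emit (fun _ => false))
  (ForV depth Tu Ju Zu (fun f => ForV 0 Tv Jv Zv (fun f' => Emit (fun o => eE o f f')))))))).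

Lemma zeros_constants N : zeros [:: Tu; Ju; Zu; Tv; Jv; Zv] (constants N).
Proof.
by move=> X; rewrite !inE => /or4P[|||/or3P[]] /eqP->.
Qed.

Lemma map_nseq_true (T : Type) (s : seq T) : [seq true | _ <- s] = nseq (size s) true.
Proof. by elim: s => //= x s ->. Qed.

Lemma ok_rt (S : Type) (pt : seq bool -> S -> payload B) k Xs P g (u : seq bool -> S) :
  ok pt k Xs P g -> {subset Xs <= [:: Tu; Ju; Zu; Tv; Jv; Zv]} ->
  rt P (fun x => cfg x (fun=> 0) (constants (size x)) (pt x (u x)))
       (fun x => cfg x (fun=> 0) (constants (size x)) (pt x (g x (constants (size x)) (u x)))).
Proof.
move=> H sX.
apply: (okf_rt (s := fun x => (constants (size x), pt x (u x)))
  (s' := fun x => (constants (size x), pt x (g x (constants (size x)) (u x)))) H) => x.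
by exists (constants (size x)), (u x); split=> // X /sX; exact: zeros_constants.
Qed.

Lemma rt_Write : rt Write
  (fun x => cfg x (fun=> 0) (constants (size x)) (ptE x [::]))
  (fun x => cfg x (fun=> 0) (constants (size x)) (ptE x (inst x))).
Proof.
pose Xs := [:: Tu; Ju; Zu; Tv; Jv; Zv].
have lvD : (depth <= D1)%N by rewrite /D1; lia.
have H1 : ok ptE D1 Xs _ _ := ok_weak lvD (fun _ h => h)
  (ok_ForV hcm lvD DD (isT : uniq Xs) (fun _ : tag => ok_Emit 0 [:: Tv; Jv; Zv] (fun=> true))).
have H2 c : ok ptE D1 Xs _ _ := ok_Emit D1 Xs (fun=> c).
have l1 : (0 + cJ <= D1)%N by rewrite /D1 /depth; lia.
have l2 : (0 + cJ + cT <= D1)%N by rewrite /D1 /depth; lia.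
have H3 : ok ptE D1 Xs _ _ := ok_weak l2
  (_ : {subset [:: Tu; Ju] <= Xs})
  (ok_LoopC l2 DD (isT : Tu \notin [:: Ju]) (ok_LoopC l1 DD (isT : Ju \notin [::])
    (ok_Emit 0 [::] (fun=> true)))).
have {}H3 := H3 _.
have H4 : ok ptE D1 Xs _ _ := ok_ForV hcm (leqnn D1) DD (isT : uniq Xs) (fun f =>
  ok_ForV hcm lvD DD (isT : uniq [:: Tv; Jv; Zv]) (fun f' =>
    ok_Emit 0 [::] (fun o => eE o f f'))).
have H := ok_Seq H1 (ok_Seq (H2 false) (ok_Seq (H2 true) (ok_Seq (H3 _) (ok_Seq (H2 false) H4)))).
have /H {}H : {subset [:: Tu; Ju] <= Xs}.
  by move=> X; rewrite !inE => /orP[] ->; rewrite ?orbT.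
have R := ok_rt (fun=> [::]) H (fun _ h => h).
congr rt: R; apply/funext => x; congr (cfg _ _ _ (ptE _ _)).
rewrite /inst; set L := labels _; move: L => L.
rewrite foldl_rcons /= map_nseq_true.
have E a c w : foldl (fun u _ => foldl (fun u _ => rcons u true) u (iota 0 a)) w
    (iota 0 c) = w ++ nseq (c * a) true.
  rewrite -{2}(size_iota 0 c); elim: (iota 0 c) w => /= [|_ s IH] w.
    by rewrite cats0.
  by rewrite IH foldl_rcons map_nseq_true size_iota mulSn nseqD catA.
rewrite E (eq_foldl (g := fun w u => w ++
    [seq eE (ob x (pair_vals x u v)) u.1 v.1 | v <- L])); last first.
  by move=> w u; rewrite foldl_rcons.
rewrite foldl_cats -!cats1 -!catA /=.
by [].
Qed.

(** * Running the approximation algorithm *)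

Variable pB : {poly nat}.
Hypothesis haltB : forall x,
  halting (iter pB.[size (inst x)] (@step B) (init B [:: inst x])).1.

Definition afterB (x : seq bool) : 'I_(ntapes B).+1 -> atape A :=
  abs_conf (iter pB.[size (inst x)] (@step B) (init B [:: inst x])).

Lemma size_block b (f : tag) hz :
  size (block cT cJ b f hz) = (b ^ cT * (b ^ cJ * b ^ hz))%N.
Proof.
rewrite (size_flatten_map _ (m := b ^ cJ * b ^ hz)%N) ?size_iota // => t.
by rewrite (size_flatten_map _ (m := b ^ hz)%N) ?size_iota // => j; rewrite size_map size_iota.
Qed.

Lemma size_labels b : size (labels b) =
  (#|G| * (b ^ cT * (b ^ cJ * b ^ h)) + #|Q| * (b ^ cT * (b ^ cJ * b ^ cm))).+1.
Proof.
rewrite /labels /= size_cat (size_flatten_map _ (fun g => size_block b (Some (inl g)) h)).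
by rewrite (size_flatten_map _ (fun g => size_block b (Some (inr g)) cm)) -!cardE.
Qed.

Lemma size_inst x (n := size (labels (size x + 2))) :
  size (inst x) = (n + ((size x + 2) ^ cT * (size x + 2) ^ cJ + n * n) + 3)%N.
Proof.
rewrite /inst -/n; set w := [seq _ | u <- _, v <- _].
have wE : size w = (n * n)%N by rewrite size_allpairs.
by move: w wE => w wE; rewrite !(size_cat, size_nseq, wE) /= size_cat size_nseq /= wE; lia.
Qed.

Lemma pbound_pow c : pbound (fun N => (N + 2) ^ c)%N.
Proof. by exists c. Qed.

Lemma pbound_labels : pbound (fun N => size (labels (N + 2))).
Proof.
apply: pbound_le (fun N => eq_leq (size_labels _)) _.
apply: (@pbound_le _ (fun N => #|G| * ((N + 2) ^ cT * ((N + 2) ^ cJ * (N + 2) ^ h)) +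
  #|Q| * ((N + 2) ^ cT * ((N + 2) ^ cJ * (N + 2) ^ cm)) + 1)%N).
  by move=> N; rewrite addn1.
by do ?[apply: pboundD | apply: pboundM | exact: pbound_const | exact: pbound_pow].
Qed.

Definition szI (N : nat) : nat :=
  let n := size (labels (N + 2)) in (n + ((N + 2) ^ cT * (N + 2) ^ cJ + n * n) + 3)%N.

Lemma pbound_szI : pbound szI.
Proof.
have H := pbound_labels.
by do ?[apply: pboundD | apply: pboundM | exact: pbound_const | exact: pbound_pow | exact: H].
Qed.

Definition ptR (x : seq bool) : payload B :=
  fun i => if i == tOut then wt (bits A (inst x)) 0 else blank_payload i.

Definition ptA (x : seq bool) : payload B :=
  fun i => if i is inl j then afterB x j else wt [:: mark] 0.

(** The head must return to the first bit of the instance; as the other tapes of [B] are still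
    blank, this is its initial configuration. *)
Definition RunB : gmach I A :=
  Seq (Rew (tP _ tOut)) (Emb (fun j => tP _ (inl j))
    (fun i => if i is Some (inr (inl j)) then Some j else None)).

Lemma rt_RunB : rt RunB
  (fun x => cfg x (fun=> 0) (constants (size x)) (ptE x (inst x)))
  (fun x => cfg x (fun=> 0) (constants (size x)) (ptA x)).
Proof.
apply: (@rt_Seq _ _ _ (fun x => cfg x (fun=> 0) (constants (size x)) (ptR x))).
  exists (fun N => 3 * szI N + 5)%N.
    exact: pboundD (pboundM (pbound_const 3) pbound_szI) (pbound_const 5).
  move=> x; set C := cfg _ _ _ _.
  have := @runs_Rew B D C (tP _ tOut) (bits A (inst x)) (size (inst x)) erefl.
  rewrite size_map => /(_ (leqnn _)).
  have -> : sett C (tP _ tOut) (wt (bits A (inst x)) 0) =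
      cfg x (fun=> 0) (constants (size x)) (ptR x).
    apply/funext => -[[[k|[Y Z]]|i]|] //; rewrite /sett /= /ptR /ptE.
    have -> : (Some (inr i) == tP _ tOut :> I) = (i == tOut) by [].
    by case: eqP.
  move=> H; rewrite size_inst in H; apply: H.
  by apply/allP => a /mapP[b _ ->].
exists (fun N => pB.[szI N]); first exact: pbound_horner pbound_szI.
move=> x.
have -> : pB.[szI (size x)] = pB.[size (inst x)] by rewrite size_inst.
have := @runs_Emb I B (fun j => tP _ (inl j))
  (fun i => if i is Some (inr (inl j)) then Some j else None) (fun=> erefl)
  (cfg x (fun=> 0) (constants (size x)) (ptR x)) (init B [:: inst x]) _ erefl (haltB x).
set U := glue _ _ _; set V := glue _ _ _.
have -> : U = cfg x (fun=> 0) (constants (size x)) (ptR x).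
  apply/funext => -[[[k|[Y Z]]|[j|f]]|] //; rewrite /U /glue /= /ptR /blank_payload /abs_conf.
  rewrite ffunE abs_word_tape.
  have -> : (inl j == tOut :> Pl) = (j == ord0) by [].
  by case: eqP => [->|/eqP j0] //; case: j j0 => -[|j] jj //; rewrite nth_default.
have -> // : V = cfg x (fun=> 0) (constants (size x)) (ptA x).
by apply/funext => -[[[k|[Y Z]]|[j|f]]|].
Qed.

(** * Checking the returned set *)

(** The state consists of the displacement of the head on the output tape since [B] halted, the flag
    telling whether the current vertex has been found near the set, and the verdict so far. *)
Definition ptC (x : seq bool) (u : int * bool * bool) : payload B := fun i => match i with
  | inl j => if j == ord0 then fun z => afterB x ord0 (z + u.1.1) else afterB x j
  | inr false => wt [:: Some (inl u.1.2)] 0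
  | inr true => wt [:: Some (inl u.2)] 0
  end.

(** The head on the output advances by one bit per enumerated vertex, so the bit it reads tells
    whether that vertex was returned. *)
Definition Scan (f : obs -> bool) : gmach I A :=
  @PAct B D (fun o r i => (if (i == tFlag) && (r tOut == mark) && f o then mark else r i,
     if i == tOut then GoRight else Stay)).

Definition Back : gmach I A :=
  @PAct B D (fun o r i => (r i, if i == tOut then GoLeft else Stay)).

Definition Clear : gmach I A :=
  @PAct B D (fun o r i => (if i == tFlag then Some (inl false) else r i, Stay)).

Definition Collect : gmach I A :=
  @PAct B D (fun o r i =>
    (if (i == tRes) && (r tFlag != mark) then Some (inl false) else r i, Stay)).

Lemma wt1_put (a b : symbol A) : awm (wt [:: a] 0) (b, Stay) = wt [:: b] 0.
Proof.
by rewrite -[RHS](@wt_put _ [:: a] 0 b) //; apply/funext => z; rewrite /awm addr0.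
Qed.

Lemma ptC_move x i f r m :
  awm (ptC x (i, f, r) tOut) (ptC x (i, f, r) tOut 0, m) = ptC x (i + mvd m, f, r) tOut.
Proof.
apply/funext => z; rewrite /awm /put /=; case: eqP => [e|_]; congr (afterB _ _ _); lia.
Qed.

Lemma ok_Scan k Xs f : ok ptC k Xs (Scan f) (fun x v u =>
  (u.1.1 + 1, u.1.2 || ((afterB x ord0 u.1.1 == mark) && f (ob x v)), u.2)).
Proof.
apply: ok_PAct => x v [[i fl] r] [j|[]] /=.
- have -> : (inl j == tOut :> Pl) = (j == ord0) by [].
  case: (j == ord0); last exact: awm_stay.
  exact: (ptC_move x i fl r GoRight).
- exact: awm_stay.
- rewrite add0r /= wt1_put.
  by case: fl => /=; case: ifP.
Qed.

Lemma ok_Back k Xs : ok ptC k Xs Back (fun x v u => (u.1.1 - 1, u.1.2, u.2)).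
Proof.
apply: ok_PAct => x v [[i fl] r] [j|[]] /=; try exact: awm_stay.
have -> : (inl j == tOut :> Pl) = (j == ord0) by [].
case: (j == ord0); last exact: awm_stay.
exact: (ptC_move x i fl r GoLeft).
Qed.

Lemma ok_Clear k Xs : ok ptC k Xs Clear (fun x v u => (u.1.1, false, u.2)).
Proof.
apply: ok_PAct => x v [[i fl] r] [j|[]] /=; try exact: awm_stay.
exact: wt1_put.
Qed.

Lemma ok_Collect k Xs : ok ptC k Xs Collect (fun x v u => (u.1.1, u.1.2, u.2 && u.1.2)).
Proof.
apply: ok_PAct => x v [[i fl] r] [j|[]] /=; try exact: awm_stay.
by rewrite wt1_put; case: fl; case: r.
Qed.

Definition is_chain (f : tag) : bool := if f is Some (inl _) then true else false.

(** The check enumerates [v] in the outer loop and [u] in the inner one, opposite to the order in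
    [pair_vals]. *)
Lemma setlC v (a b : label) : setl Tu Ju Zu (setl Tv Jv Zv v a) b =
  setl Tv Jv Zv (setl Tu Ju Zu v b) a.
Proof.
case: a => fa [[t j] z]; case: b => fb [[t' j'] z']; apply/funext => X; rewrite /setl /setv /=.
by case: X => -[|[|[|[|[|[|[|[|[|[|[|[|]]]]]]]]]]]].
Qed.

(** For each vertex off the chains, one pass over the output looks for a returned vertex near it,
    and a second pass only brings the head back. *)
Definition Check : gmach I A :=
  ForV depth Tv Jv Zv (fun f => if is_chain f then Skip B D else
    Seq Clear (Seq (ForV 0 Tu Ju Zu (fun f' => Scan (fun o => nE o f' f)))
      (Seq (ForV 0 Tu Ju Zu (fun _ => Back)) Collect))).

Definition root_label : label := (None, (0, 0, 0)%N).

Definition found (x : seq bool) (u : label) : bool :=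
  let ls := labels (size x + 2) in
  has (fun k : nat => (afterB x ord0 k == mark) &&
         nE (ob x (pair_vals x (nth root_label ls k) u)) (nth root_label ls k).1 u.1) (iota 0 (size ls)).

Definition verdict (x : seq bool) : bool :=
  all (fun u => is_chain u.1 || found x u) (labels (size x + 2)).

(** The flag that the last round leaves behind is left unspecified as [f]. *)
Lemma rt_Check : exists f : seq bool -> bool, rt Check
  (fun x => cfg x (fun=> 0) (constants (size x)) (ptC x (0, true, true)))
  (fun x => cfg x (fun=> 0) (constants (size x)) (ptC x (0, f x, verdict x))).
Proof.
pose Xs := [:: Tv; Jv; Zv; Tu; Ju; Zu].
pose Ys := [:: Tu; Ju; Zu].
have lvD : (depth <= D1)%N by rewrite /D1; lia.
have H1 f : ok ptC depth Ys _ _ := ok_ForV hcm lvD DD (isT : uniq Ys)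
   (fun f' => ok_Scan 0 [::] (fun o => nE o f' f)).
have H2 : ok ptC depth Ys _ _ := ok_ForV hcm lvD DD (isT : uniq Ys)
   (fun _ : tag => ok_Back 0 [::]).
have H3 f := ok_Seq (ok_Clear depth Ys) (ok_Seq (H1 f) (ok_Seq H2 (ok_Collect depth Ys))).
pose g (f : tag) (x : seq bool) (v : cval) (u : int * bool * bool) :=
  let ls := labels (size x + 2) in
  let fd := has (fun k : nat => (afterB x ord0 (u.1.1 + k%:Z) == mark) &&
         nE (ob x (setl Tu Ju Zu v (nth root_label ls k))) (nth root_label ls k).1 f) (iota 0 (size ls)) in
  if is_chain f then u else (u.1.1, fd, u.2 && fd).
have H4 f : ok ptC depth Ys (if is_chain f then Skip B D else
    Seq Clear (Seq (ForV 0 Tu Ju Zu (fun f' => Scan (fun o => nE o f' f)))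
      (Seq (ForV 0 Tu Ju Zu (fun _ => Back)) Collect))) (g f).
  case E : (is_chain f).
    apply: (ok_ext (g := fun _ _ u => u)); last exact: ok_Skip.
    by move=> x v u _; rewrite /g E.
  apply: ok_ext (H3 f) => x v u _; rewrite /g E.
  set ls := labels _; move: ls => ls.
  rewrite (foldl_scan (fun i l => (afterB x ord0 i == mark) &&
    nE (ob x (setl Tu Ju Zu v l)) l.1 f) root_label) /=.
  set fd := has _ _; have -> : forall i b r (s : seq label),
    foldl (fun (u0 : int * bool * bool) _ => (u0.1.1 - 1, u0.1.2, u0.2)) (i, b, r) s =
      (i - (size s)%:Z, b, r).
    move=> i b r; move=> s; elim: s i => [|a s IH] i /=; first by rewrite subr0.
    by rewrite IH; congr (_, _, _); lia.
  by rewrite /= addrK.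
have H5 : ok ptC D1 Xs Check _ := ok_ForV hcm (leqnn D1) DD (isT : uniq Xs) H4.
have XsS : {subset Xs <= [:: Tu; Ju; Zu; Tv; Jv; Zv]} by apply/allP.
have R := ok_rt (fun=> (0, true, true)) H5 XsS.
have E x : exists b, foldl (fun u l => g l.1 x (setl Tv Jv Zv (constants (size x)) l) u)
    (0, true, true) (labels (size x + 2)) = (0, b, verdict x).
  rewrite /verdict; move: (labels _) => s.
  have : forall b r, exists b', foldl (fun u l => g l.1 x (setl Tv Jv Zv (constants (size x)) l) u)
    (0, b, r) s = (0, b', r && all (fun u => is_chain u.1 || found x u) s).
    elim: s => [|a s IH] b r /=; first by exists b; rewrite andbT.
    have -> : g a.1 x (setl Tv Jv Zv (constants (size x)) a) (0, b, r) =
       (0, if is_chain a.1 then b else found x a, r && (is_chain a.1 || found x a)).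
      rewrite /g; set fd := has _ _.
      have -> : fd = found x a by apply: eq_has => k; rewrite add0r setlC.
      by case: (is_chain a.1); rewrite /= ?andbT.
    have [b' ->] := IH (if is_chain a.1 then b else found x a) (r && (is_chain a.1 || found x a)).
    by exists b'; rewrite andbA.
  by move=> /(_ true true)[b' ->]; exists b'.
exists (fun x => projT1 (cid (E x))).
congr rt: R; apply/funext => x; congr (cfg _ _ _ (ptC _ _)).
exact: (projT2 (cid (E x))).
Qed.

Definition Answer : gmach I A :=
  Act (fun (r : I -> symbol A) (i : I) => if i is None then (r (tP _ tRes), Stay) else keep r i).

Hypothesis cC0 : (0 < cC)%N.

Theorem decider : exists (M : machine) (p : {poly nat}), forall x,
  outputs_within M [:: x] p.[size x] [:: verdict x].
Proof.
have [f HC] := rt_Check.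
have e1 : (fun x => cfg x (fun=> 0) (constants (size x)) blank_payload) =
    (fun x => cfg x (fun=> 0) (constants (size x)) (ptE x [::])).
  apply/funext => x; congr (cfg _ _ _ _); apply/funext => i; rewrite /ptE.
  by case: eqP => // ->.
have e2 : (fun x => cfg x (fun=> 0) (constants (size x)) (ptA x)) =
    (fun x => cfg x (fun=> 0) (constants (size x)) (ptC x (0, true, true))).
  apply/funext => x; congr (cfg _ _ _ _); apply/funext => -[j|[]] //=.
  case: eqP => [->|//]; by apply/funext => z; rewrite addr0.
pose F x := upd (cfg x (fun=> 0) (constants (size x)) (ptC x (0, f x, verdict x)))
  (fun i => let r := heads (cfg x (fun=> 0) (constants (size x)) (ptC x (0, f x, verdict x))) in
     if i is None then (r (tP _ tRes), Stay) else keep r i).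
have HA : rt Answer (fun x => cfg x (fun=> 0) (constants (size x)) (ptC x (0, f x, verdict x))) F.
  by exists (fun=> 1%N) => [|x]; [exact: pbound_const | exact: runs_Act].
have HW := rt_Write; rewrite -e1 in HW; rewrite -e2 in HC.
have [t pt H] := rt_Seq rt_Setup (rt_Seq (rt_Consts (fun=> blank_payload))
  (rt_Seq HW (rt_Seq rt_RunB (rt_Seq HC HA)))).
have [p tp] := pbound_poly pt.
eexists (to_machine _), p => x.
apply: to_machine_outputs (runs_le (H x) (tp _)) _ _.
- by [].
(* As [Jv] is 0, the input head stands [(size x + 2) ^ cC], hence at least 2, cells to the left of
   the input. The answer written there is followed by a blank. *)
- rewrite /F /upd /heads /awm /put /= addr0 /= /wt /constants /=.
  have : (2 <= (size x + 2) ^ cC)%N.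
    by rewrite -[2%N](expn1 2); apply: leq_trans (leq_pexp2l _ cC0) _; rewrite ?leq_exp2r ?leq_addl.
  by case E : (_ + _) => [n|n] //; lia.
Qed.

End Decider.

Local Close Scope ring_scope.

(** * The labels of the vertices *)

Definition quad (G : finType) : finType := option (G * G * G * G)%type.

Section Labels.
Variables (G Q : finType) (cT cJ h cm b : nat).
Let T := b ^ cT. Let W := b ^ cJ. Let L := b ^ h. Let M := b ^ cm.
Local Notation label := (label G Q).
Let ls : seq label := labels G Q cT cJ h cm b.

Lemma mem_block f hz (l : label) :
  (l \in block cT cJ b f hz) =
  [&& l.1 == f, l.2.1.1 < b ^ cT, l.2.1.2 < b ^ cJ & l.2.2 < b ^ hz].
Proof.
case: l => f' [[t j] z] /=; apply/flatten_mapP/and4P.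
  case=> t' t'T /flatten_mapP[j' j'W /mapP[z' z'L [-> -> -> ->]]].
  by move: t'T j'W z'L; rewrite !mem_iota !add0n.
case=> /eqP-> tT jW zL; exists t; first by rewrite mem_iota.
apply/flatten_mapP; exists j; first by rewrite mem_iota.
by apply/mapP; exists z; rewrite ?mem_iota.
Qed.

Definition valid (l : label) : bool :=
  match l.1 with
  | None => l.2 == (0, 0, 0)
  | Some (inl _) => [&& l.2.1.1 < T, l.2.1.2 < W & l.2.2 < L]
  | Some (inr _) => [&& l.2.1.1 < T, l.2.1.2 < W & l.2.2 < M]
  end.

Lemma mem_labels l : (l \in ls) = valid l.
Proof.
rewrite inE mem_cat; case: l => [[[g|q]|] p].
- rewrite [_ == _]/= /=; apply/orP/idP => [[]|H].
  + by case/flatten_mapP => g' _; rewrite mem_block => /and4P[_ *]; apply/and3P.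
  + by case/flatten_mapP => g' _; rewrite mem_block => /and4P[].
  + left; apply/flatten_mapP; exists g; first by rewrite mem_enum.
    by rewrite mem_block eqxx.
- rewrite [_ == _]/= /=; apply/orP/idP => [[]|H].
  + by case/flatten_mapP => g' _; rewrite mem_block => /and4P[].
  + by case/flatten_mapP => g' _; rewrite mem_block => /and4P[_ *]; apply/and3P.
  + right; apply/flatten_mapP; exists q; first by rewrite mem_enum.
    by rewrite mem_block eqxx.
- rewrite /valid /= -pair_eqE /= /pair_eq /=.
  case: (p == _) => //=; apply/negbTE/norP; split; apply/flatten_mapP => -[g' _];
    by rewrite mem_block.
Qed.

(** The list contains the injective image of a finite type whose cardinal is the length of the
    list. *)
Lemma uniq_labels : uniq ls.
Proof.
pose F : finType := option (G * 'I_T * 'I_W * 'I_L + Q * 'I_T * 'I_W * 'I_M)%type.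
pose lab (a : F) : label := match a with
  | None => (None, (0, 0, 0))
  | Some (inl (g, t, j, z)) => (Some (inl g), (nat_of_ord t, nat_of_ord j, nat_of_ord z))
  | Some (inr (q, t, j, z)) => (Some (inr q), (nat_of_ord t, nat_of_ord j, nat_of_ord z))
  end.
have lab_inj : injective lab.
  move=> [[[[[g t] j] z]|[[[g t] j] z]]|] [[[[[g' t'] j'] z']|[[[g' t'] j'] z']]|] //=
    [-> /ord_inj-> /ord_inj-> /ord_inj->] //.
apply: (@leq_size_uniq _ (map lab (enum F))).
- by rewrite map_inj_uniq ?enum_uniq.
- move=> _ /mapP[a _ ->]; rewrite mem_labels.
  by case: a => [[[[[g t] j] z]|[[[g t] j] z]]|] //=; rewrite /valid /= !ltn_ord.
- rewrite size_map -cardE size_labels card_option card_sum !card_prod !card_ord.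
  by rewrite /T /W /L /M !mulnA.
Qed.

Lemma count_chain : count (fun l => is_chain l.1) ls = #|G| * (T * (W * L)).
Proof.
rewrite /ls /labels /= add0n count_cat.
have E1 (s : seq label) : all (fun l => is_chain l.1) s -> count (fun l => is_chain l.1) s = size s.
  by rewrite all_count => /eqP.
have E2 (s : seq label) : all (fun l => ~~ is_chain l.1) s -> count (fun l => is_chain l.1) s = 0.
  by move=> H; apply/eqP; rewrite -leqn0 leqNgt -has_count -all_predC.
rewrite E1 ?E2 ?addn0.
- by rewrite (size_flatten_map _ (fun g => size_block cT cJ b (Some (inl g)) h)) -cardE.
- apply/allP => l /flatten_mapP[q _]; rewrite mem_block => /and4P[/eqP-> //].
- apply/allP => l /flatten_mapP[q _]; rewrite mem_block => /and4P[/eqP-> //].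
Qed.
End Labels.

(** * The graph and its selected sets *)

Section Gap.
Variables (R : realType) (G : finType) (cT cJ h cm b : nat).
Let T := b ^ cT. Let W := b ^ cJ. Let L := b ^ h. Let M := b ^ cm.
Variable okc : nat -> nat -> G -> G -> G -> G -> bool.
Local Notation label := (label G (quad G)).
Let ls : seq label := labels G (quad G) cT cJ h cm b.

(* The element [Some (g1, g2, g3, g4)] of the cell (t, j) forbids that pattern at
   (t, j - 1), (t, j), (t, j + 1), (t + 1, j); when the pattern is allowed it
   duplicates the element [None], which only asks for a value at (t, j). *)
Definition covers (g : G) (t' j' : nat) (o : quad G) (t j : nat) : bool :=
  if o is Some (g1, g2, g3, g4) then
    if okc t j g1 g2 g3 g4 then (t' == t) && (j' == j) else
    [|| [&& t' == t, j'.+1 == j & g != g1], [&& t' == t, j' == j & g != g2],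
        [&& t' == t, j' == j.+1 & g != g3] | [&& t' == t.+1, j' == j & g != g4]]
  else (t' == t) && (j' == j).

(** A chain is entered from the root at its start and left for the elements at its end, so an
    element is at distance at least [L + 1] from the root. *)
Definition edge (u v : label) : bool :=
  let: (fu, (t', j', z')) := u in let: (fv, (t, j, z)) := v in
  match fu, fv with
  | None, Some (inl _) => z == 0
  | Some (inl g'), Some (inl g) => [&& g' == g, t' == t, j' == j & z == z'.+1]
  | Some (inl g'), Some (inr o) => (z'.+1 == L) && covers g' t' j' o t j
  | _, _ => false
  end.

(* Any vertex of the chain of a covering set counts, not only the last one:
   replacing it by the last one only brings the elements closer. *)
Definition near (u v : label) : bool :=
  (u == v) || match u, v with
  | (Some (inl g'), (t', j', _)), (Some (inr o), (t, j, _)) => covers g' t' j' o t j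
  | _, _ => false
  end.

(** A neighbour outside the tableau ranges over all values: no set belongs to that place, so none
    can break a pattern there. *)
Definition sat (z : nat -> nat -> G) : Prop :=
  forall t j g1 g2 g3 g4, t < T -> j < W ->
  (0 < j -> g1 = z t j.-1) -> g2 = z t j -> (j.+1 < W -> g3 = z t j.+1) ->
  (t.+1 < T -> g4 = z t.+1 j) -> okc t j g1 g2 g3 g4.

Let n := size ls.
Let r0 : label := (None, (0, 0, 0)).
Definition lab (i : 'I_n) : label := nth r0 ls i.
Definition graph : rel 'I_n := fun i j => edge (lab i) (lab j).

Lemma lab_inj : injective lab.
Proof.
move=> i j /eqP; rewrite nth_uniq ?ltn_ord ?uniq_labels // => /eqP; exact: ord_inj.
Qed.

Lemma lab_valid i : valid cT cJ h cm b (lab i).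
Proof. by rewrite -mem_labels mem_nth. Qed.

Lemma lab_surj l : valid cT cJ h cm b l -> exists i, lab i = l.
Proof.
rewrite -mem_labels -/ls => /(nthP r0)[i ii <-]; by exists (Ordinal ii).
Qed.

(** A topological order: the root, the chains by position, the elements. *)
Definition rank (l : label) : nat :=
  match l.1 with None => 0 | Some (inl _) => l.2.2.+1 | Some (inr _) => L.+1 end.

Lemma edge_rank u v : edge u v -> rank u < rank v.
Proof.
case: u v => [[[g'|o']|] [[t' j'] z']] [[[g|o]|] [[t j] z]] //=.
- by case/and4P => _ _ _ /eqP->; rewrite /rank /=.
- by case/andP => /eqP e _; rewrite /rank /= e.
Qed.

Lemma path_rank i p : path graph i p -> all (fun j => rank (lab i) < rank (lab j)) p.
Proof.
elim: p i => //= j p IH i /andP[/edge_rank ij /IH/allP H]; rewrite ij /=.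
by apply/allP => k /H; exact: ltn_trans.
Qed.

Lemma acyclic_graph : acyclic graph.
Proof.
case=> // i c /= /path_rank/allP/(_ i); rewrite mem_rcons mem_head ltnn => H.
by have := H isT.
Qed.

Local Notation k := (T * W).+1.

Definition passes (S : {set 'I_n}) : bool :=
  all (fun u => is_chain u.1 || [exists i in S, near (lab i) u]) ls.

Hypothesis b0 : 0 < b.
Hypothesis kM : k < M.

(** An element has [M] copies, and [S] can contain at most [k] of them. *)
Lemma copies_outside (S : {set 'I_n}) o t j : #|S| = k -> t < T -> j < W ->
  M - k <= #|[set i | (i \notin S) && ((lab i).1 == Some (inr o)) && ((lab i).2.1 == (t, j))]|.
Proof.
move=> Sk tT jW.
have vl (m : 'I_M) : valid cT cJ h cm b ((Some (inr o), (t, j, nat_of_ord m)) : label).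
  by rewrite /valid; apply/and3P; split=> //=; exact: ltn_ord.
pose c (m : 'I_M) : 'I_n := projT1 (cid (lab_surj (vl m))).
have cE m : lab (c m) = (Some (inr o), (t, j, nat_of_ord m)) by exact: (projT2 (cid (lab_surj (vl m)))).
have c_inj : injective c.
  by move=> m m' /(congr1 lab); rewrite !cE => -[/ord_inj].
rewrite leq_subLR -Sk -[X in X <= _](card_ord M) -(card_codom c_inj).
set X := [set i | _]; apply: (@leq_trans #|S :|: X|); last by rewrite cardsU leq_subr.
apply: subset_leq_card; apply/fintype.subsetP => i /codomP[m ->].
by rewrite finset.in_setU finset.in_set cE /= !eqxx !andbT; case: (_ \in S).
Qed.

(** As [k < M], every element has a copy outside [S], which must then be covered by a chain vertex
    of [S]; and only the root is near the root. So the root and one chain vertex for each of the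
    [T * W] cells use up [S], and every cell gets exactly one value. *)
Lemma passes_sat (S : {set 'I_n}) : #|S| = k -> passes S -> exists z, sat z.
Proof.
move=> Sk /allP pS.
pose f i : option (nat * nat) := if (lab i).1 is None then None else Some (lab i).2.1.
pose ks : seq (option (nat * nat)) :=
  None :: [seq Some p | p <- [seq (t, j) | t <- iota 0 T, j <- iota 0 W]].
have uks : uniq ks.
  rewrite /= map_inj_uniq; last by move=> ? ? [].
  rewrite allpairs_uniq ?iota_uniq //; last by move=> [? ?] [? ?] _ _ [-> ->].
  by rewrite andbT; apply/mapP => -[].
have sks : size ks = k by rewrite /= size_map size_allpairs !size_iota.
have elem o t j : t < T -> j < W -> exists g t' j' z i,
    [/\ i \in S, lab i = (Some (inl g), (t', j', z)) & covers g t' j' o t j].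
  move=> tT jW; have := copies_outside o Sk tT jW.
  have : 0 < M - k by rewrite subn_gt0.
  move=> /leq_trans /[apply] /card_gt0P[u]; rewrite finset.in_set => /andP[/andP[uS /eqP uo] /eqP utj].
  have /pS : lab u \in ls by rewrite mem_nth.
  rewrite uo /= => /exists_inP[i iS].
  rewrite /near; case/orP => [/eqP/lab_inj iu|]; first by rewrite -iu iS in uS.
  case: (lab u) uo utj => _ [[t0 j0] z0] /= -> [-> ->].
  case E : (lab i) => [[[g|?]|] [[t' j'] z]] // cv.
  by exists g, t', j', z, i.
have chain t j : t < T -> j < W -> exists g z i,
    i \in S /\ lab i = (Some (inl g), (t, j, z)).
  move=> tT jW; have [g [t' [j' [z [i [iS li /andP[/eqP e1 /eqP e2]]]]]]] := elem None t j tT jW.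
  by exists g, z, i; rewrite -e1 -e2.
(* On the [k] vertices of [S] the map [f] takes the [k] distinct values in [ks]. *)
have f_inj : {in S &, injective f}.
  apply/dinjectiveP; rewrite /dinjectiveb.
  apply: (leq_size_uniq uks); last by rewrite size_map -cardE Sk sks.
  move=> a; rewrite inE => /orP[/eqP->|/mapP[_ /allpairsP[[t j] [tT jW ->]] ->]].
    have /pS : r0 \in ls by rewrite mem_head.
    rewrite /= => /exists_inP[i iS nr]; apply/mapP; exists i; first by rewrite mem_enum.
    move: nr; rewrite /near /f; case: (lab i) => [[[g|?]|] [[t' j'] z]] //.
  move: tT jW; rewrite !mem_iota => /= tT jW.
  have [g [z [i [iS li]]]] := chain t j tT jW.
  by apply/mapP; exists i; rewrite ?mem_enum // /f li.
have [g0 _] : exists g : G, True.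
  have T0 : 0 < T by rewrite expn_gt0 b0.
  have W0 : 0 < W by rewrite expn_gt0 b0.
  by have [g _] := chain 0 0 T0 W0; exists g.
pose z t j := if [pick i in S | is_chain (lab i).1 && ((lab i).2.1 == (t, j))] is Some i
  then if (lab i).1 is Some (inl g) then g else g0 else g0.
have zE g t j y i : i \in S -> lab i = (Some (inl g), (t, j, y)) -> z t j = g.
  move=> iS li; rewrite /z; case: pickP => [i' /andP[i'S]|/(_ i)]; last first.
    by rewrite iS li /= eqxx.
  case E : (lab i') => [[[g'|?]|] [[t' j'] y']] //= /eqP[? ?]; subst t' j'.
  have : i' = i by apply: f_inj => //; rewrite /f E li.
  by move=> e; move: E; rewrite e li => -[].
exists z => t j g1 g2 g3 g4 tT jW e1 e2 e3 e4.
(* Were the pattern forbidden, its element would be covered by a selected set whose value differs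
   from the pattern at one of the four cells; but there the pattern agrees with [z]. *)
have [g [t' [j' [y [i [iS li]]]]]] := elem (Some (g1, g2, g3, g4)) t j tT jW.
rewrite /covers; case: (okc _ _ _ _ _ _) => //.
have := lab_valid i; rewrite li /valid /= => /and3P[t'T j'W _].
have zi := zE _ _ _ _ _ iS li.
case/or4P => /and3P[/eqP et /eqP ej /eqP ng]; case: ng; rewrite -zi.
- by rewrite e1 -?ej // et.
- by rewrite e2 et ej.
- by rewrite e3 -?ej // et.
- by rewrite e4 -?et // ej.
Qed.

(** * Distance sums of good and bad sets *)

Local Open Scope ereal_scope.

Lemma dist_le (u v : 'I_n) p : path graph u p -> last u p = v ->
  dist R graph u v <= (size p)%:R%:E.
Proof. by move=> H1 H2; apply: ereal_inf_lbound; exists p. Qed.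

Lemma le_dist (u v : 'I_n) (c : nat) :
  (forall p, path graph u p -> last u p = v -> (c <= size p)%N) ->
  c%:R%:E <= dist R graph u v.
Proof.
move=> H; apply: le_ereal_inf_tmp => _ [p [H1 H2] <-].
by rewrite lee_fin ler_nat; exact: H.
Qed.

Lemma set_dist_le (S : {set 'I_n}) u v : u \in S ->
  set_dist R graph S v <= dist R graph u v.
Proof. by move=> uS; exact: bigmin_le_cond. Qed.

Lemma le_set_dist (S : {set 'I_n}) v (c : nat) :
  (forall u p, u \in S -> path graph u p -> last u p = v -> (c <= size p)%N) ->
  c%:R%:E <= set_dist R graph S v.
Proof.
move=> H; apply: le_bigmin => [|u uS]; first exact: leey.
by apply: le_dist => p; exact: H.
Qed.

Lemma set_dist_ge0 (S : {set 'I_n}) v : 0 <= set_dist R graph S v.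
Proof. exact: (@le_set_dist S v 0%N). Qed.

(** Take the root and, for each cell, the last vertex of the chain of its value. Every copy of an
    element is then at distance 1, and every chain vertex at distance at most [L] from the root. *)
Lemma good_sum z : sat z -> exists2 S : {set 'I_n}, #|S| = k &
  \sum_(v in ~: S) set_dist R graph S v <= (n + L * (#|G| * (T * (W * L))))%:R%:E.
Proof.
move=> sz.
have L0 : (0 < L)%N by rewrite expn_gt0 b0.
have vc (p : 'I_T * 'I_W) : valid cT cJ h cm b
    ((Some (inl (z p.1 p.2)), (nat_of_ord p.1, nat_of_ord p.2, L.-1)) : label).
  by rewrite /valid /= !ltn_ord /= prednK.
pose c p : 'I_n := projT1 (cid (lab_surj (vc p))).
have cE p : lab (c p) = (Some (inl (z p.1 p.2)), (nat_of_ord p.1, nat_of_ord p.2, L.-1)).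
  exact: (projT2 (cid (lab_surj (vc p)))).
have [r rE] : exists r, lab r = r0 by apply: lab_surj.
pose S := [set r] :|: [set c p | p : 'I_T * 'I_W].
have c_inj : injective c.
  by move=> [t j] [t' j'] /(congr1 lab); rewrite !cE /= => -[_ /ord_inj-> /ord_inj->].
have rS : r \in S by rewrite finset.in_setU finset.in_set1 eqxx.
have cS t j : (t < T)%N -> (j < W)%N -> exists2 i, i \in S &
    lab i = (Some (inl (z t j)), (t, j, L.-1)).
  move=> tT jW; exists (c (Ordinal tT, Ordinal jW)); last by rewrite cE.
  by rewrite finset.in_setU; apply/orP; right; apply/imsetP; exists (Ordinal tT, Ordinal jW).
exists S.
  rewrite cardsU1 card_imset // card_prod !card_ord.
  case: imsetP => [[p _ rp]|_]; last by rewrite add1n.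
  by move: rE; rewrite rp cE.
have bound v : v \notin S ->
    set_dist R graph S v <= (1 + L * is_chain (lab v).1)%:R%:E.
  move=> vS; have := lab_valid v; case lv : (lab v) => [[[g|o]|] [[t j] y]].
  - rewrite /valid /= => /and3P[tT jW yL].
    apply: le_trans (set_dist_le v rS) _.
    have : exists2 p, path graph r p /\ last r p = v & size p = y.+1.
      elim: y v {vS} lv yL => [|y IH] v lv yL.
        by exists [:: v] => //=; rewrite /graph rE lv.
      have vu : valid cT cJ h cm b ((Some (inl g), (t, j, y)) : label).
        by rewrite /valid; apply/and3P; split=> //; exact: ltnW.
      have [u uE] := lab_surj vu.
      have [p [p1 p2] sp] := IH u uE (ltnW yL).
      exists (rcons p v); last by rewrite size_rcons sp.
      by rewrite rcons_path p1 p2 last_rcons /graph uE lv /= !eqxx.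
    case=> p [p1 p2] sp; apply: le_trans (dist_le p1 p2) _.
    by rewrite sp lee_fin ler_nat muln1 add1n ltnW.
  - rewrite /valid /= => /and3P[tT jW yL]; rewrite muln0 addn0.
    have [i iS iv] : exists2 i, i \in S & graph i v.
      rewrite /graph lv.
      case: o lv => [[[[g1 g2] g3] g4]|] lv; last first.
        have [i iS li] := cS t j tT jW; exists i => //.
        by rewrite li /= prednK // !eqxx.
      case ok : (okc t j g1 g2 g3 g4).
        have [i iS li] := cS t j tT jW; exists i => //.
        by rewrite li /= prednK // /covers ok !eqxx.
      (* Otherwise [sat] would allow the pattern. So [z] differs from it at the cell or at a
         neighbour inside the tableau, and the set selected there covers the element. *)
      have : [|| (0 < j)%N && (z t j.-1 != g1), z t j != g2,
          (j.+1 < W)%N && (z t j.+1 != g3) | (t.+1 < T)%N && (z t.+1 j != g4)].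
        apply/negPn/negP; rewrite !negb_or !negb_and !negbK.
        move=> /and4P[h1 /eqP h2 h3 h4]; move: ok; rewrite sz //.
        - by move=> j0; move: h1; rewrite j0 /= => /eqP.
        - by move=> j0; move: h3; rewrite j0 /= => /eqP.
        - by move=> t0; move: h4; rewrite t0 /= => /eqP.
      case/or4P => [/andP[j0 ng]|ng|/andP[jW' ng]|/andP[tT' ng]].
      + have [i iS li] := cS t j.-1 tT (leq_ltn_trans (leq_pred j) jW); exists i => //.
        by rewrite li /= prednK // /covers ok ng prednK // !eqxx.
      + have [i iS li] := cS t j tT jW; exists i => //.
        by rewrite li /= prednK // /covers ok ng !eqxx orbT.
      + have [i iS li] := cS t j.+1 tT jW'; exists i => //.
        by rewrite li /= prednK // /covers ok ng !eqxx !orbT.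
      + have [i iS li] := cS t.+1 j tT' jW; exists i => //.
        by rewrite li /= prednK // /covers ok ng !eqxx !orbT.
    apply: le_trans (set_dist_le v iS) _.
    by apply: (@dist_le i v [:: v]) => //=; rewrite iv.
  - rewrite /valid /= => /eqP e; case/negP: vS; rewrite (_ : v = r) //.
    by apply: lab_inj; rewrite rE lv e.
apply: (@le_trans _ _ (\sum_(v in ~: S) (1 + L * is_chain (lab v).1)%:R%:E)).
  by apply: lee_sum => v; rewrite finset.in_setC; exact: bound.
apply: (@le_trans _ _ (\sum_(v : 'I_n) (1 + L * is_chain (lab v).1)%:R%:E)).
  by apply: lee_sum_nneg_subset => [v _|v _] //; rewrite lee_fin ler0n.
rewrite sumEFin -natr_sum lee_fin ler_nat big_split /= sum1_card card_ord leq_add2l.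
rewrite -big_distrr leq_mul2l; apply/orP; right.
rewrite -(@count_chain G (quad G) cT cJ h cm b) -/ls.
rewrite -(big_mkord xpredT (fun i => (is_chain (nth r0 ls i).1 : nat))).
rewrite -(big_nth r0 xpredT (fun l => (is_chain l.1 : nat))) -sum1_count [X in (_ <= X)%N]big_mkcond.
by apply: leq_sum => l _; case: (is_chain _).
Qed.

(** Covering does not depend on the copy, so if one copy is missed, any path from [S] to a copy
    outside [S] must run through a whole covering chain. This concerns at least [M - k] copies. *)
Lemma bad_sum (S : {set 'I_n}) : #|S| = k -> ~~ passes S ->
  ((M - k) * L)%:R%:E <= \sum_(v in ~: S) set_dist R graph S v.
Proof.
move=> Sk /allPn[u]; rewrite mem_labels negb_or => uv /andP[uc /exists_inPn nu].
case: u uv uc nu => [[[g|o]|] [[t j] m]] //; rewrite /valid /=; last first.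
  move=> /eqP[-> -> ->] _ nu.
  have [r rE] : exists r, lab r = r0 by apply: lab_surj.
  have rS : r \notin S by apply/negP => /nu; rewrite /near rE eqxx.
  rewrite (bigD1 r) /=; last by rewrite finset.in_setC.
  apply: (@le_trans _ _ (set_dist R graph S r)); last first.
    by apply: leeDl; apply: sume_ge0 => v _; exact: set_dist_ge0.
  (* No edge enters the root, so no path from [S] reaches it and any lower bound holds. *)
  apply: le_set_dist => i p iS pi lp; case/lastP: p pi lp => [|p v] /=.
    by move=> _ ir; rewrite -ir iS in rS.
  rewrite rcons_path last_rcons => /andP[_]; rewrite /graph => ev vr; move: ev.
  by rewrite vr rE; case: (lab _) => [[[?|?]|] [[? ?] ?]].
move=> /and3P[tT jW mM] _ nu.
pose C := [set i | (i \notin S) && ((lab i).1 == Some (inr o)) && ((lab i).2.1 == (t, j))].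
have CM : (M - k <= #|C|)%N by exact: copies_outside.
apply: (@le_trans _ _ (\sum_(v in C) (L%:R : R)%:E)).
  rewrite sumEFin sumr_const -mulrnA lee_fin ler_nat mulnC.
  by rewrite leq_mul2l CM orbT.
apply: (@le_trans _ _ (\sum_(v in C) set_dist R graph S v)); last first.
  apply: lee_sum_nneg_subset => [v|v _]; last exact: set_dist_ge0.
  by rewrite finset.in_set finset.in_setC => /andP[/andP[]].
apply: lee_sum => w; rewrite finset.in_set => /andP[/andP[wS /eqP w1] /eqP w2].
apply: le_set_dist => i p iS pi lp.
have {}nu := nu i iS.
(* A lower bound on the distance to [w]. *)
pose pot (l : label) : nat := if l == lab w then 0%N else
  if l is (Some (inl g'), (t', j', z')) then
    if covers g' t' j' o t j then (L - z')%N else L else L.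
have potE x y : graph x y -> (pot (lab x) <= (pot (lab y)).+1)%N.
  have := lab_valid x; rewrite /graph /pot.
  case: (altP eqP) => // _; case: (altP eqP) => [->|_]; last first.
    case: (lab x) => [[[g'|?]|] [[t' j'] z']]; case: (lab y) => [[[g''|?]|] [[t'' j''] z'']] //=.
      by move=> _ /and4P[/eqP<- /eqP<- /eqP<- /eqP->]; case: ifP => _ //; lia.
    by move=> _ _; case: ifP; lia.
    by move=> _ /eqP->; case: ifP => _; lia.
  case: (lab w) w1 w2 => _ [[? ?] ?] /= -> [-> ->].
  case: (lab x) => [[[g'|?]|] [[t' j'] z']] //= _ /andP[/eqP zL ->].
  by rewrite -zL; lia.
have : forall x q, path graph x q -> (pot (lab x) <= size q + pot (lab (last x q)))%N.
  move=> x q; elim: q x => [|y q IH] x //= /andP[/potE xy /IH yq].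
  by apply: leq_trans xy _; rewrite addSn ltnS.
move=> /(_ i p pi); rewrite lp /pot eqxx addn0.
case: eqP => [/lab_inj iw|_]; first by rewrite -iw iS in wS.
move: nu; rewrite /near; case: (lab i) => [[[g'|?]|] [[t' j'] z']] //=.
by move=> /negbTE->.
Qed.

(** If [S] failed, then [GC S] would be at most [n / bad] while the maximum is at least [n / good],
    against the assumed gap between the two sums. *)
Lemma approx_passes (S : {set 'I_n}) (alpha : R) :
  (0 < alpha)%R -> #|S| = k -> (exists z, sat z) ->
  alpha%:E * max_GC R graph k <= GC R graph S ->
  ((n + L * (#|G| * (T * (W * L))))%:R < alpha * ((M - k) * L)%:R)%R ->
  passes S.
Proof.
move=> a0 Sk [z /good_sum[S0 S0k gS0]] ap lt; apply/negPn/negP => /(bad_sum Sk).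
move: gS0 ap lt; set good := (n + _)%N; set bad := ((M - k) * L)%N => gS0 ap lt bS.
have n0 : (0 < n)%N by [].
have g0 : (0 < good%:R :> R)%R by rewrite ltr0n; lia.
have bd0 : (0 < bad%:R :> R)%R.
  by have := lt_trans g0 lt; rewrite pmulr_rgt0.
have s0 A : 0 <= \sum_(v in ~: A) set_dist R graph A v.
  by apply: sume_ge0 => v _; exact: set_dist_ge0.
have inv_mono (x y : \bar R) : 0 <= x -> x <= y -> y^-1 <= x^-1.
  by move=> x0 xy; rewrite lee_pV2 // inE /= ?x0 // (le_trans x0).
have nn : 0 <= (n%:R : R)%:E by rewrite lee_fin ler0n.
have G0 : n%:R%:E / good%:R%:E <= GC R graph S0.
  by rewrite /GC card_ord; apply: lee_wpmul2l => //; exact: inv_mono.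
have G1 : GC R graph S <= n%:R%:E / bad%:R%:E.
  by rewrite /GC card_ord; apply: lee_wpmul2l => //; apply: inv_mono => //; rewrite lee_fin ltW.
have G2 : GC R graph S0 <= max_GC R graph k.
  by apply: (@le_bigmax_cond _ _ _ _ S0 (fun T : {set 'I_n} => #|T| == k)); rewrite S0k.
have : alpha%:E * (n%:R%:E / good%:R%:E) <= n%:R%:E / bad%:R%:E.
  apply: le_trans G1; apply: le_trans ap; apply: lee_wpmul2l; first by rewrite lee_fin ltW.
  exact: le_trans G0 G2.
rewrite !inver !gt_eqF // -!EFinM lee_fin => H.
have np : (0 < n%:R :> R)%R by rewrite ltr0n.
move: H; rewrite mulrCA ler_pM2l // ler_pdivrMr // mulrC ler_pdivlMr // => H.
by have := lt_le_trans lt H; rewrite ltxx.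
Qed.

End Gap.

(** * Computation tableaux of the verifier *)

Section Tableau.
Variable V : machine.
Local Notation I := 'I_(ntapes V).+1.

Definition cell : finType := {ffun I -> option (bool + extra V)}.
(* State, symbols under the heads (repeated in every column), symbols in the column. *)
Definition Gam : finType := (state V * cell * cell)%type.

(** A halting state rewrites its symbols in place, which continues the tableau to the last row. *)
Definition delta (s : state V * cell) : state V * {ffun I -> symbol (extra V) * move} :=
  if halting s.1 then (s.1, [ffun i => (s.2 i, Stay)]) else trans s.1 s.2.

(* The booleans locate the cell (t, j): j = 0, j + 1 = J, j = C, j + 1 = C,
   j = C + 1, j = CQ, t = 0, t + 1 = T; [rx] is the input bit expected there. *)
Definition okb (j0 jJ jC jCm jCp jQ t0 tT : bool) (rx : option bool)
    (g1 g2 g3 g4 : Gam) : bool :=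
  [&& jJ || (g2.1 == g3.1),
      jC ==> (g2.1.2 == g2.2),
      tT || ((g4.1.1 == (delta g2.1).1) &&
        (g4.2 == [ffun i => let am := (delta g2.1).2 i in
          match am.2 with
          | GoLeft => if j0 then None else if jCp then am.1 else g1.2 i
          | Stay => if jC then am.1 else g2.2 i
          | GoRight => if jJ then None else if jCm then am.1 else g3.2 i
          end])),
      t0 ==> (g2.1.1 == start V) && [forall i : I,
        match val i with
        | 0 => g2.2 i == omap inl rx
        | 1 => [&& if g2.2 i is Some (inr _) then false else true,
                   (g2.2 i != None) ==> jC || ~~ j0 && (g1.2 i != None) &
                   jQ ==> (g2.2 i == None)]
        | _ => g2.2 i == None
        end] &
      tT ==> jC ==> (g2.2 ord0 == Some (inl true))].

Variables (x : seq bool) (T J C q : nat).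
Hypothesis T0 : 0 < T.
Hypothesis TC : T <= C.
Hypothesis CJ : (maxn (size x) q).+1 + T + C <= J.

Definition rdx (j : nat) : option bool :=
  if (j%:Z - C%:Z)%R is Posz m then if m < size x then Some (nth false x m) else None
  else None.

Definition okc (t j : nat) : Gam -> Gam -> Gam -> Gam -> bool :=
  okb (j == 0) (j.+1 == J) (j == C) (j.+1 == C) (j == C.+1) (j == C + q)
    (t == 0) (t.+1 == T) (rdx j).

Section Run.
Variable w : seq bool.
Hypothesis wq : size w <= q.

Definition run (t : nat) : config V := iter t (@step V) (init V [:: x; w]).
Definition tp (t : nat) (i : I) : atape (extra V) := abs_tape ((run t).2 i).
Definition cellt (t : nat) (p : int) : cell := [ffun i => tp t i p].
Definition truth (t j : nat) : Gam :=
  ((run t).1, cellt t 0, cellt t (j%:Z - C%:Z)%R).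

Lemma run_delta t : (run t.+1).1 = (delta ((run t).1, cellt t 0)).1 /\
  forall i, tp t.+1 i = awm (tp t i) ((delta ((run t).1, cellt t 0)).2 i).
Proof.
rewrite /tp /run iterS -/(run t).
have -> : cellt t 0 = [ffun i => under_head ((run t).2 i)].
  by apply/ffunP => i; rewrite !ffunE /tp; case: ((run t).2 i).
case: (run t) => s U; rewrite /step /delta /=.
case: ifP => hs /=.
  by split=> // i; rewrite !ffunE; case: (U i) => l u r; exact/esym/(awm_stay (abs_tape (Tape l u r))).
case E : (trans s _) => [s' act] /=; split=> // i.
by rewrite ffunE abs_tape_wm.
Qed.

Lemma tp0 i : tp 0 i = wt (bits (extra V) (nth [::] [:: x; w] i)) 0.
Proof. by rewrite /tp /run /= ffunE abs_word_tape. Qed.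

(** In [t] steps a head drifts at most [t] cells away from the initial word and can have written no
    further. *)
Lemma blank t i p : (p < - t%:Z)%R \/ (((maxn (size x) q).+1 + t)%:Z <= p)%R -> tp t i p = None.
Proof.
elim: t p => [|t IH] p hp.
  rewrite tp0 /wt addr0; case: p hp => // m hp.
  rewrite nth_default // size_map; case: i => -[|[|i]] ii /=; try lia.
  by rewrite nth_nil.
rewrite (run_delta t).2 /awm /put; move: ((delta _).2 i) => [a m].
have hp' : (p + mvd m < - t%:Z)%R \/ (((maxn (size x) q).+1 + t)%:Z <= p + mvd m)%R.
  by case: m; rewrite /mvd; lia.
case: eqP => [e|_]; last exact: IH.
move: e hp'; rewrite /=; lia.
Qed.

(** Row [t + 1] is relative to the moved head: its column [j] comes from column [j - 1], [j] or
    [j + 1] of row [t], and shows the written symbol when that column is [C]. What enters at the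
    borders is blank. *)
Lemma next_truth t j (g1 g2 g3 : Gam) : t < T -> j < J ->
  (0 < j -> g1 = truth t j.-1) -> g2 = truth t j -> (j.+1 < J -> g3 = truth t j.+1) ->
  (delta g2.1).1 = (run t.+1).1 /\
  [ffun i => let am := (delta g2.1).2 i in
          match am.2 with
          | GoLeft => if j == 0 then None else if j == C.+1 then am.1 else g1.2 i
          | Stay => if j == C then am.1 else g2.2 i
          | GoRight => if j.+1 == J then None else if j.+1 == C then am.1 else g3.2 i
          end] = cellt t.+1 (j%:Z - C%:Z)%R.
Proof.
move=> tT jJ e1 -> e3; have [-> H] := run_delta t; split=> //.
apply/ffunP => i; rewrite !ffunE H /awm /put; set am := _ i.
case: am => a [] /=.
- case: (eqVneq j 0) => [j0|j0].
    rewrite j0; case: eqP => [|_]; first lia.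
    by rewrite blank //; left; lia.
  rewrite e1 ?lt0n //= ffunE.
  have -> : (j%:Z - C%:Z + -1)%R = (j.-1%:Z - C%:Z)%R by lia.
  by have -> : (j == C.+1) = ((j.-1%:Z - C%:Z)%R == 0) by lia.
- rewrite addr0.
  by have -> : (j == C) = ((j%:Z - C%:Z)%R == 0) by lia.
- case: (eqVneq j.+1 J) => [jE|jE].
    case: eqP => [|_]; first lia.
    by rewrite blank //; right; lia.
  rewrite e3 /= ?ffunE; last by rewrite ltn_neqAle jE.
  have -> : (j%:Z - C%:Z + 1)%R = (j.+1%:Z - C%:Z)%R by lia.
  by have -> : (j.+1 == C) = ((j.+1%:Z - C%:Z)%R == 0) by lia.
Qed.

Lemma rdxE j (A : Type) : omap inl (rdx j) = wt (bits A x) 0 (j%:Z - C%:Z)%R.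
Proof.
rewrite /rdx /wt addr0; case: (_ - _)%R => // m.
case: ltnP => mx; last by rewrite nth_default ?size_map.
by rewrite (nth_map false).
Qed.

Lemma truth_ok t j g1 g2 g3 g4 : t < T -> j < J ->
  under_head ((run T.-1).2 ord0) = Some (inl true) ->
  (0 < j -> g1 = truth t j.-1) -> g2 = truth t j -> (j.+1 < J -> g3 = truth t j.+1) ->
  (t.+1 < T -> g4 = truth t.+1 j) -> okc t j g1 g2 g3 g4.
Proof.
move=> tT jJ acc e1 e2 e3 e4; rewrite /okc /okb.
have [d1 d2] := next_truth tT jJ e1 e2 e3.
apply/and5P; split.
- case: (eqVneq j.+1 J) => //= jE; rewrite e3 ?e2 //.
  by rewrite ltn_neqAle jE.
- by rewrite e2; apply/implyP => /eqP->; rewrite /= subrr.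
- rewrite d1 d2; case: (eqVneq t.+1 T) => //= tE; rewrite e4 /= ?eqxx //.
  by rewrite ltn_neqAle tE.
- apply/implyP => /eqP t0; rewrite e2 t0 /= eqxx /=; apply/forallP => i.
  rewrite ffunE tp0; case: i => -[|[|i]] ii /=.
  + by rewrite rdxE.
  + apply/and3P; split.
    * rewrite /wt addr0; case: (_ - _)%R => // m.
      by elim: (w) m => [|b w' IH] [|m] //=; exact: IH.
    * apply/implyP => h; case: (eqVneq j C) => //= jC.
      have j0 : 0 < j.
        by rewrite lt0n; apply/eqP => j0; move: h; rewrite j0 /wt addr0; case E : (_ - _)%R => [m|m] //; lia.
      rewrite -lt0n j0 e1 // ffunE t0 tp0 /=.
      move: h; rewrite /wt !addr0; case E : (_ - _)%R => [m|m] //.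
      have -> : (j.-1%:Z - C%:Z)%R = m.-1 by lia.
      have m0 : 0 < m by lia.
      case: (ltnP m (size w)) => mw; last by rewrite nth_default // size_map.
      have mw' : m.-1 < size w by lia.
      by move=> _; rewrite (nth_map false).
    * apply/implyP => /eqP->; rewrite /wt addr0.
      have -> : ((C + q)%:Z - C%:Z)%R = q by lia.
      by rewrite nth_default // size_map.
  + by rewrite nth_nil /wt; case: (_ + 0)%R => // m; rewrite nth_nil.
- apply/implyP => /eqP tE; apply/implyP => /eqP jC.
  rewrite e2 jC /= subrr ffunE /tp.
  have -> : t = T.-1 by rewrite -tE.
  by move: acc; case: ((run T.-1).2 ord0) => l u r /= ->.
Qed.
End Run.

(** Row 0 yields a certificate [w], and by induction the constraints force every row to be that of
    the run on [x] and [w]. *)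
Lemma sat_truth (z : nat -> nat -> Gam) :
  (forall t j g1 g2 g3 g4, t < T -> j < J ->
    (0 < j -> g1 = z t j.-1) -> g2 = z t j -> (j.+1 < J -> g3 = z t j.+1) ->
    (t.+1 < T -> g4 = z t.+1 j) -> okc t j g1 g2 g3 g4) ->
  exists2 w, size w <= q & under_head ((run w T.-1).2 ord0) = Some (inl true).
Proof.
move=> sz.
have H t j (tT : t < T) (jJ : j < J) := sz t j (z t j.-1) (z t j) (z t j.+1) (z t.+1 j) tT jJ
  (fun _ => erefl) erefl (fun _ => erefl) (fun _ => erefl).
have CJ' : C < J by lia.
have [w wq w0] : exists2 w, size w <= q & forall j, j < J -> forall i,
    (z 0 j).2 i = tp w 0 i (j%:Z - C%:Z)%R.
  have H0 j i : j < J -> match val i with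
        | 0 => (z 0 j).2 i = omap inl (rdx j)
        | 1 => [/\ is_true (if (z 0 j).2 i is Some (inr _) then false else true),
                   ((z 0 j).2 i != None) -> (j == C) || (j != 0) && ((z 0 j.-1).2 i != None) &
                   j = C + q -> (z 0 j).2 i = None]
        | _ => (z 0 j).2 i = None
        end.
    move=> jJ; have /and5P[_ _ _ + _] := H 0 j T0 jJ; rewrite /= => /andP[_ /forallP/(_ i)].
    case: (val i) => [|[|k]]; [exact/eqP | | exact/eqP].
    by case/and3P => h1 /implyP h2 /implyP h3; split=> // /eqP/h3/eqP.
  have base w i j : j < J -> val i != 1 -> (z 0 j).2 i = tp w 0 i (j%:Z - C%:Z)%R.
    move=> jJ i1; rewrite tp0; have := H0 j i jJ.
    case: i i1 => -[|[|i]] ii //= _ ->; first exact: rdxE.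
    by rewrite nth_nil /wt; case: (_ + 0)%R => // m; rewrite nth_nil.
  (* A verifier with a single tape never sees the certificate, and the empty word will do. *)
  have [V1|V1] := ltnP 1 (ntapes V).+1; last first.
    exists [::] => // j jJ i; apply: base => //.
    by apply/eqP => i1; have := ltn_ord i; rewrite -[nat_of_ord i]/(val i) i1; lia.
  pose i1 : I := Ordinal V1; pose f j := (z 0 j).2 i1.
  have fB j (jJ : j < J) : _ := H0 j i1 jJ.
  (* Off column [C], a non-blank cell needs a non-blank left neighbour, which column 0 does not
     have. *)
  have fneg j : j < C -> f j = None.
    elim: j => [|j IH] jC; apply/eqP/negPn/negP => fj.
      by have [_ /(_ fj)] := fB 0 (leq_trans jC (ltnW CJ')); rewrite /= orbF; lia.
    have [_ /(_ fj)] := fB j.+1 (ltn_trans jC CJ'); rewrite ltn_eqF //=.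
    by rewrite -/(f j) IH ?eqxx // ltnW.
  have fq : f (C + q) = None.
    have qJ : C + q < J by lia.
    by have [_ _ ] := fB _ qJ; apply.
  (* The certificate extends from column [C] to the first blank; column [C + q] is blank, so its
     length is at most [q]. *)
  have exm : exists k, f (C + k) == None by exists q; rewrite fq.
  case: (ex_minnP exm) => m fm mmin.
  have mq : m <= q by apply: mmin; rewrite fq.
  have ftail k : C + (m + k) < J -> f (C + (m + k)) = None.
    elim: k => [|k IH] kJ; first by rewrite addn0 (eqP fm).
    apply/eqP/negPn/negP => fj; have [_ /(_ fj)] := fB _ kJ.
    have -> : (C + (m + k.+1) == C) = false by lia.
    by rewrite !addnS /= -/(f _) IH ?eqxx ?andbF //; lia.
  exists (mkseq (fun k => if f (C + k) is Some (inl b) then b else false) m).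
    by rewrite size_mkseq.
  move=> j jJ i; case: (eqVneq (val i) 1) => [ie|]; last exact: base.
  have -> : i = i1 by apply: val_inj.
  rewrite tp0 -/(f j) /= /wt addr0; case: (ltnP j C) => jC.
    by rewrite fneg //; case E : (_ - _)%R => [k|k] //; lia.
  have [k jE] : exists k, j = C + k by exists (j - C); rewrite subnKC.
  have -> : (j%:Z - C%:Z)%R = k by lia.
  case: (ltnP k m) => km; last first.
    rewrite [RHS]nth_default; last by rewrite size_map size_mkseq.
    by rewrite jE -(subnKC km) ftail // subnKC // -jE.
  rewrite [RHS](nth_map false) ?size_mkseq // nth_mkseq // -jE.
  have [] := fB j jJ; rewrite -/(f j).
  case E : (f j) => [[b|a]|] // _ _ _.
  by have := mmin k; rewrite -jE E => /(_ isT); lia.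
exists w => //.
(* The head symbols are constant along a row and agree at column [C] with the content of that
   column. *)
have P t : t < T -> (forall j, j < J -> (z t j).1.1 = (run w t).1 /\
    (z t j).2 = cellt w t (j%:Z - C%:Z)%R) -> forall j, j < J -> z t j = truth w t j.
  move=> tT h; have e j : j < J -> (z t j).1 = (z t 0).1.
    elim: j => // j IH jJ; rewrite -IH; last exact: ltnW.
    by have /and5P[] := H t j tT (ltnW jJ); rewrite ltn_eqF //= => /eqP->.
  move=> j jJ; have [h1 h2] := h j jJ.
  have /and5P[_ + _ _ _] := H t C tT CJ'; rewrite eqxx /= (e C CJ') -(e j jJ) => /eqP h3.
  have [_ h4] := h C CJ'; move: h3; rewrite h4 subrr.
  by move: h1 h2; case: (z t j) => [[s r] c] /= -> -> ->.
have Q t : t < T -> forall j, j < J -> z t j = truth w t j.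
  elim: t => [|t IH] tT.
    apply: P => // j jJ; split; last by apply/ffunP => i; rewrite ffunE w0.
    by have /and5P[_ _ _ + _] := H 0 j tT jJ; rewrite /= => /andP[/eqP].
  have {}IH := IH (ltnW tT).
  apply: P => // j jJ.
  have /and5P[_ _ + _ _] := H t j (ltnW tT) jJ; rewrite ltn_eqF //=.
  have [|||-> ->] := @next_truth w wq t j (z t j.-1) (z t j) (z t j.+1) (ltnW tT) jJ.
  - by move=> j0; apply: IH; exact: leq_ltn_trans (leq_pred j) jJ.
  - exact: IH.
  - exact: IH.
  by case/andP => /eqP-> /eqP->.
have TT : T.-1 < T by rewrite prednK.
have /and5P[_ _ _ _] := H T.-1 C TT CJ'.
rewrite prednK // !eqxx /= Q //= subrr => /eqP; rewrite ffunE /tp.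
by case: ((run w T.-1).2 ord0).
Qed.

End Tableau.

(** * Agreement of the machine with the graph *)

Lemma cmp_true m n : (cmp m n == Some true) = (m == n).
Proof. by rewrite /cmp; case: (m =P n) => // _; case: (m =P n.+1). Qed.

Lemma cmp_false m n : (cmp m n == Some false) = (m == n.+1).
Proof.
rewrite /cmp; case: (m =P n) => [->|_]; first by rewrite (ltn_eqF (ltnSn n)).
by case: (m =P n.+1).
Qed.

Section Reduction.
Variables (V : machine) (cT cJ cC h cm : nat) (q : {poly nat}).
Local Notation G := (Gam V).
Local Notation Q := (quad G).

(** Here and below, [okc], [covers], [edge] and [near] are recomputed from the symbols under the
    heads, which are all that a transition sees. *)
Definition okO (o : obs) : G -> G -> G -> G -> bool :=
  okb (o.1 Jv CO == Some true) (o.1 CJ Jv == Some false) (o.1 Jv CW == Some true)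
    (o.1 CW Jv == Some false) (o.1 Jv CW == Some false) (o.1 Jv CQ == Some true)
    (o.1 Tv CO == Some true) (o.1 CT Tv == Some false) o.2.

Definition coversO (o : obs) (g : G) (a : Q) : bool :=
  let same := (o.1 Tu Tv == Some true) && (o.1 Ju Jv == Some true) in
  if a is Some (g1, g2, g3, g4) then
    if okO o g1 g2 g3 g4 then same else
    [|| [&& o.1 Tu Tv == Some true, o.1 Jv Ju == Some false & g != g1],
        [&& o.1 Tu Tv == Some true, o.1 Ju Jv == Some true & g != g2],
        [&& o.1 Tu Tv == Some true, o.1 Ju Jv == Some false & g != g3] |
        [&& o.1 Tu Tv == Some false, o.1 Ju Jv == Some true & g != g4]]
  else same.

Definition edgeO (o : obs) (fu fv : tag G Q) : bool :=
  match fu, fv with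
  | None, Some (inl _) => o.1 Zv CO == Some true
  | Some (inl g'), Some (inl g) => [&& g' == g, o.1 Tu Tv == Some true,
      o.1 Ju Jv == Some true & o.1 Zv Zu == Some false]
  | Some (inl g'), Some (inr a) => (o.1 CL Zu == Some false) && coversO o g' a
  | _, _ => false
  end.

Definition nearO (o : obs) (fu fv : tag G Q) : bool :=
  [&& fu == fv, o.1 Tu Tv == Some true, o.1 Ju Jv == Some true & o.1 Zu Zv == Some true] ||
  match fu, fv with
  | Some (inl g'), Some (inr a) => coversO o g' a
  | _, _ => false
  end.

Variable x : seq bool.
Let b := size x + 2.
Definition okx := @okc V x (b ^ cT) (b ^ cJ) (b ^ cC) q.[size x]%R.

Local Notation pair_vals := (pair_vals cT cJ cC h q x).

Lemma okO_pair (u v : label G Q) : okO (ob x (pair_vals u v)) = okx v.2.1.1 v.2.1.2.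
Proof.
case: u => fu [[t' j'] z']; case: v => fv [[t j] z].
rewrite /okO /okx /okc !cmp_true !cmp_false.
by congr okb; rewrite /pair_vals /setl /setv /constants /= // eq_sym.
Qed.

Lemma coversO_pair g t' j' z' a t j z :
  coversO (ob x (pair_vals (Some (inl g), (t', j', z')) (Some (inr a), (t, j, z)))) g a =
  covers okx g t' j' a t j.
Proof.
rewrite /coversO /covers okO_pair !cmp_true !cmp_false.
case: a => [[[[g1 g2] g3] g4]|] //.
by rewrite /= (eq_sym j j'.+1).
Qed.

Lemma edgeO_pair (u v : label G Q) :
  edgeO (ob x (pair_vals u v)) u.1 v.1 = edge h b okx u v.
Proof.
case: u => [[[g'|a']|] [[t' j'] z']]; case: v => [[[g|a]|] [[t j] z]] //=.
- by rewrite !cmp_true !cmp_false.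
- by rewrite coversO_pair cmp_false eq_sym.
- by rewrite cmp_true.
Qed.

Lemma nearO_pair (u v : label G Q) :
  nearO (ob x (pair_vals u v)) u.1 v.1 = near okx u v.
Proof.
rewrite /nearO /near !cmp_true; congr orb.
  case: u => fu [[t' j'] z']; case: v => fv [[t j] z].
  by rewrite /= !xpair_eqE !andbA.
case: u => [[[g'|a']|] [[t' j'] z']]; case: v => [[[g|a]|] [[t j] z]] //=.
exact: coversO_pair.
Qed.

Local Notation ls := (labels G Q cT cJ h cm b).
Local Notation graphx := (@graph G cT cJ h cm b okx).

Lemma inst_encode :
  inst cT cJ cC h cm q edgeO x = encode_instance graphx (b ^ cT * b ^ cJ).+1.
Proof.
have ml : map (@lab G cT cJ h cm b) (enum 'I_(size ls)) = ls.
  rewrite -[RHS](mkseq_nth (None, (0, 0, 0))) /mkseq -val_enum_ord -map_comp.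
  exact: eq_map.
rewrite /inst /encode_instance; congr (_ ++ _ :: _ ++ _ :: _).
rewrite -/b -{1 2}ml allpairs_mapl allpairs_mapr.
by apply: eq_allpairs => i j; rewrite edgeO_pair.
Qed.

Variable (B : machine) (pB : {poly nat}) (S : {set 'I_(size ls)}).
Hypothesis outB :
  output (iter pB.[size (inst cT cJ cC h cm q edgeO x)]%R (@step B)
    (init B [:: inst cT cJ cC h cm q edgeO x])) = encode_set S.

(** Bit [k] of the output says whether the vertex with the [k]-th label belongs to [S]. *)
Lemma verdict_passes :
  verdict B cT cJ cC h cm q edgeO nearO pB x = passes okx S.
Proof.
rewrite /verdict /passes; apply: eq_all => u; congr orb.
have sS : size (encode_set S) = size ls by rewrite size_map size_enum_ord.
have aE (k : nat) (kn : k < size ls) :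
    (afterB cT cJ cC h cm q edgeO pB x ord0 k == mark B) = (Ordinal kn \in S).
  rewrite /afterB (output_nth outB) ?sS //.
  rewrite (nth_map (Ordinal kn)) ?size_enum_ord // (nth_ord_enum _ (Ordinal kn)).
  by case: (_ \in S).
apply/hasP/exists_inP => [[k]|[i iS ni]].
  rewrite mem_iota add0n => /andP[_ kn]; rewrite (aE k kn) nearO_pair => /andP[kS nk].
  by exists (Ordinal kn).
exists (nat_of_ord i); first by rewrite mem_iota leq0n add0n ltn_ord.
rewrite (aE _ (ltn_ord i)) nearO_pair; apply/andP; split=> //.
by rewrite (_ : Ordinal _ = i) //; apply: val_inj.
Qed.

End Reduction.

(** * Choice of the exponents and the inclusion of NP in P *)

Local Open Scope ring_scope.

(** This follows from [n ^ eps <= b ^ (m eps) <= b ^ s]; neither the constant 4 nor the cap at 1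
    goes below [b ^ (- s)]. *)
Lemma gc_factor_ge (R : realType) (eps : R) (n b m s : nat) : 0 < eps -> (0 < n)%N ->
  (0 < b)%N -> (n <= b ^ m)%N -> m%:R * eps <= s%:R ->
  ((b ^ s)%:R)^-1 <= gc_factor eps n.
Proof.
move=> e0 n0 b0 nb ms.
have b1 : 1 <= b%:R :> R by rewrite ler1n.
have np : 0 < n%:R `^ eps :> R by rewrite powR_gt0 // ltr0n.
have bs : n%:R `^ eps <= (b ^ s)%:R :> R.
  apply: (@le_trans _ _ ((b ^ m)%:R `^ eps)).
    by apply: ge0_ler_powR; rewrite ?nnegrE ?ler0n ?ler_nat // ltW.
  by rewrite !natrX -powR_mulrn ?ler0n // -powRrM -powR_mulrn ?ler0n // ler_powR.
rewrite /gc_factor le_min; apply/andP; split.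
  by rewrite invf_le1 ?ler1n ?expn_gt0 ?b0 // ltr0n expn_gt0 b0.
rewrite powRN; apply: (@le_trans _ _ (n%:R `^ eps)^-1).
  by rewrite lef_pV2 // posrE ltr0n expn_gt0 b0.
by rewrite ler_peMl ?invr_ge0 ?ltW //; lra.
Qed.

Lemma iter_halting (M : machine) (c : config M) (s t : nat) : (s <= t)%N ->
  halting (iter s (@step M) c).1 -> iter t (@step M) c = iter s (@step M) c.
Proof.
move=> st hs; rewrite -(subnK st) iterD; elim: (t - s)%N => //= k ->.
by rewrite /step hs.
Qed.

(** Approximating on the tableau instance of [x] and checking the returned set decides [L], as the
    check succeeds exactly when an accepting tableau exists. *)
Lemma NP_sub_P (R : realType) (eps : R) (L : language) : 0 < eps < 1 / 2 ->
  polytime_approximable_on_dags (gc_factor eps) -> classNP L -> classP L.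
Proof.
move=> /andP[eps0 eps1] [B [pB HB]] [Vp [q [[V [pV HV]] HL]]].
(* A common bound for the running time of the verifier and the lengths of input and certificate.
   With [b = N + 2], the power [b ^ c] above it serves as number of rows and as origin column. *)
pose f N := (pV.[N + q.[N]] + N + q.[N] + 2)%N.
have [c fc] : pbound f.
  do ![apply: pboundD]; try exact: pbound_const; try exact: pbound_id.
    apply: pbound_horner; apply: pboundD; first exact: pbound_id.
    exact: (pbound_horner q pbound_id).
  exact: (pbound_horner q pbound_id).
(* [b ^ d] bounds the number of values and patterns, and [b ^ a] is the number of cells. With
   [L = b ^ h] and [M = b ^ (2 h)] there are at most [b ^ (e + 2 h)] vertices. *)
pose G := Gam V; pose d := (#|G| + #|{: quad G}|).+1.
pose a := (c + (c + 2))%N; pose e := (d + a + 2)%N.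
have eps2 : 0 < 1 - 2 * eps by lra.
(* This is [(e + 2 h) eps <= h - e - 3] solved for [h], possible because [eps < 1 / 2]. *)
have [h hP] : exists h : nat, (e%:R + 3 + e%:R * eps) / (1 - 2 * eps) <= h%:R.
  exists (Num.bound ((e%:R + 3 + e%:R * eps) / (1 - 2 * eps))).
  apply/ltW/archi_boundP/divr_ge0; last exact: ltW.
  by rewrite !addr_ge0 ?mulr_ge0 ?ler0n // ltW.
have {}hP : e%:R + 3 + e%:R * eps <= h%:R * (1 - 2 * eps) by rewrite -ler_pdivrMr.
have he : (e + 3 <= h)%N.
  have h1 : h%:R * (1 - 2 * eps) <= h%:R.
    by rewrite ler_piMr ?ler0n //; lra.
  have h2 : 0 <= e%:R * eps by rewrite mulr_ge0 ?ler0n // ltW.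
  by rewrite -(ler_nat R) natrD; lra.
pose s := (h - e - 3)%N.
have sP : (e + 2 * h)%:R * eps <= s%:R :> R.
  have -> : s%:R = h%:R - e%:R - 3 :> R.
    by rewrite /s -subnDA natrB // natrD; lra.
  rewrite natrD natrM; lra.
have c0 : (0 < c)%N.
  by rewrite lt0n; apply/eqP => c0; have := fc 0%N; rewrite /f c0 expn0; lia.
pose okx' (x : seq bool) := @okx V c (c + 2) c q x.
pose gr (x : seq bool) := @graph G c (c + 2) h (2 * h) (size x + 2) (okx' x).
pose k (x : seq bool) := ((size x + 2) ^ c * (size x + 2) ^ (c + 2)).+1.
pose n (x : seq bool) := size (labels G (quad G) c (c + 2) h (2 * h) (size x + 2)).
have powb (x : seq bool) i j : (i <= j)%N -> ((size x + 2) ^ i <= (size x + 2) ^ j)%N.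
  by move=> ij; rewrite leq_pexp2l // addn2.
have pow0 (x : seq bool) i : (0 < (size x + 2) ^ i)%N by rewrite expn_gt0 addn2.
have powS (x : seq bool) i : (2 * (size x + 2) ^ i <= (size x + 2) ^ i.+1)%N.
  by rewrite expnS leq_mul2r leq_addl orbT.
have kE x : k x = ((size x + 2) ^ a).+1 by rewrite /k -expnD.
have kle x : (k x <= (size x + 2) ^ a.+1)%N.
  by rewrite kE; apply: leq_trans (powS x a); have := pow0 x a; lia.
have kM x : (k x < (size x + 2) ^ (2 * h))%N.
  apply: leq_ltn_trans (kle x) _.
  by apply: leq_trans (powb x a.+2 (2 * h)%N _); [have := powS x a.+1; have := pow0 x a.+1; lia | rewrite /e in he; lia].
have gq (x : seq bool) : (#|G| + #|{: quad G}| + 1 <= (size x + 2) ^ d)%N.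
  rewrite addn1 -/d; apply: leq_trans (ltnW (ltn_expl d (isT : (1 < 2)%N))) _.
  by rewrite leq_exp2r // leq_addl.
have nE x : n x = (#|G| * (size x + 2) ^ (a + h) + #|{: quad G}| * (size x + 2) ^ (a + 2 * h)).+1.
  by rewrite /n size_labels /a !expnD !mulnA.
have nle x : (n x <= (size x + 2) ^ (d + (a + 2 * h)))%N.
  rewrite nE (expnD _ d); apply: leq_trans (leq_mul (gq x) (leqnn _)).
  have := powb x (a + h)%N (a + 2 * h)%N; have := pow0 x (a + 2 * h)%N.
  move: (_ ^ (a + h))%N (_ ^ (a + 2 * h))%N => u v v0 /(_ ltac:(lia)) uv.
  by have := leq_mul (leqnn #|G|) uv; lia.
have n0 x : (0 < n x)%N by rewrite nE.
have kn x : (k x <= n x)%N.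
  rewrite nE kE ltnS.
  have q0 : (0 < #|{: quad G}|)%N by apply/card_gt0P; exists None.
  apply: leq_trans (leq_addl _ _); apply: leq_trans (leq_pmull _ q0).
  by apply: powb; lia.
(* The good sum is at most [b ^ (e + 2 h - 1)] and the bad one at least [b ^ (3 h - 1)]. Their
   ratio, at least [b ^ (h - e)], exceeds [b ^ s], while the factor is at least [b ^ (- s)]. *)
have gap x : ((n x + (size x + 2) ^ h * (#|G| * ((size x + 2) ^ c * ((size x + 2) ^ (c + 2) *
      (size x + 2) ^ h))))%:R <
    gc_factor eps (n x) * (((size x + 2) ^ (2 * h) - k x) * (size x + 2) ^ h)%:R :> R)%R.
  set b := (size x + 2)%N in powb pow0 powS kE kle kM gq nE nle *.
  have al := @gc_factor_ge R eps (n x) b (e + 2 * h) s eps0 (n0 x) _ _ sP.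
  have {}al : ((b ^ s)%:R)^-1 <= gc_factor eps (n x).
    apply: al; first by rewrite /b addn2.
    by apply: leq_trans (nle x) _; apply: powb; rewrite /e; lia.
  apply: (@lt_le_trans _ _ (((b ^ s)%:R)^-1 * (((b ^ (2 * h) - k x) * b ^ h)%:R))); last first.
    by apply: ler_wpM2r.
  rewrite mulrC ltr_pdivlMr ?ltr0n ?pow0 // -natrM ltr_nat.
  have good : (n x + b ^ h * (#|G| * (b ^ c * (b ^ (c + 2) * b ^ h))) <= b ^ (e + 2 * h - 1))%N.
    have -> : (e + 2 * h - 1 = (d + (a + 2 * h)).+1)%N by rewrite /e; lia.
    apply: leq_trans (powS x _); rewrite mul2n -addnn leq_add ?nle //.
    have -> : (b ^ h * (#|G| * (b ^ c * (b ^ (c + 2) * b ^ h))) = #|G| * b ^ (a + 2 * h))%N.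
      by rewrite /a mul2n -addnn !expnD; lia.
    rewrite (expnD _ d) leq_mul2r; apply/orP; right; apply: leq_trans (gq x); lia.
  have bad : (b ^ (3 * h - 1) <= (b ^ (2 * h) - k x) * b ^ h)%N.
    have -> : (3 * h - 1 = (2 * h - 1) + h)%N by lia.
    rewrite expnD leq_mul2r; apply/orP; right.
    have k1 : (k x <= b ^ (2 * h - 1))%N.
      by apply: leq_trans (kle x) _; apply: powb; move: he; rewrite /e; lia.
    have := powS x (2 * h - 1)%N.
    have -> : (2 * h - 1).+1 = (2 * h)%N by lia.
    by rewrite -/b; lia.
  apply: leq_trans bad; apply: leq_ltn_trans (leq_mul good (leqnn _)) _.
  rewrite -expnD ltn_exp2l; last by rewrite /b addn2.
  by rewrite /s; lia.
have fE (x : seq bool) : (pV.[(size x + q.[size x])%N] + size x + q.[size x] + 2 <=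
    (size x + 2) ^ c)%N by exact: fc.
(* The verifier has halted by the last row, which therefore shows its final configuration; its
   one-bit answer is under head 0. *)
have accE x w : (size w <= q.[size x])%N ->
    Vp (x, w) <-> under_head ((run V x w ((size x + 2) ^ c).-1).2 ord0) = Some (inl true).
  move=> wq; have [b' [[h1 h2] h3]] := HV (x, w).
  have tT : (pV.[input_size [:: x; w]] <= ((size x + 2) ^ c).-1)%N.
    apply: (@leq_trans pV.[(size x + q.[size x])%N]).
      by apply: horner_nat_mono; rewrite /input_size /= addn0 leq_add2l.
    by have := fE x; lia.
  rewrite /run (iter_halting tT h1).
  move: h2; rewrite /output; set u := under_head _.
  case: u => [[b''|?]|] //= [e' _]; rewrite h3 -e'.
  by split=> [->|[->]].
have vsat x : L x <-> exists z, sat c (c + 2) (size x + 2) (okx' x) z.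
  have fx := fE x.
  have T0 : (0 < (size x + 2) ^ c)%N by [].
  (* The width is at least [4 b ^ c], and the words, the rows and the origin each take at most
     [b ^ c]. *)
  have CJ' : ((maxn (size x) q.[size x]).+1 + (size x + 2) ^ c + (size x + 2) ^ c <=
      (size x + 2) ^ (c + 2))%N.
    have := powS x c; have := powS x c.+1; rewrite (addn2 c); lia.
  rewrite HL; split=> [[w [wq /(accE x w wq) acc]]|[z sz]].
    exists (truth V x ((size x + 2) ^ c) w) => t j g1 g2 g3 g4 tT jJ e1 e2 e3 e4.
    exact: (truth_ok T0 (leqnn _) CJ' wq tT jJ acc e1 e2 e3 e4).
  have [w wq /(accE x w wq) acc] := sat_truth T0 (leqnn _) CJ' sz.
  by exists w.
have HS x : exists S : {set 'I_(n x)},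
    [/\ outputs_within B [:: inst c (c + 2) c h (2 * h) q (@edgeO V) x]
        pB.[size (inst c (c + 2) c h (2 * h) q (@edgeO V) x)] (encode_set S),
     #|S| = k x & ((gc_factor eps (n x))%:E * max_GC R (gr x) (k x) <= GC R (gr x) S)%E].
  have ac : acyclic (gr x) by exact: acyclic_graph.
  have := HB (n x) (gr x) (k x) ac (kn x).
  by rewrite -inst_encode.
have haltB x : halting (iter pB.[size (inst c (c + 2) c h (2 * h) q (@edgeO V) x)] (@step B)
    (init B [:: inst c (c + 2) c h (2 * h) q (@edgeO V) x])).1.
  by have [S [[]]] := HS x.
have [M [p HM]] := decider (leq_pmull h (isT : (0 < 2)%N)) (leq_addr 2 c) (@nearO V) haltB c0.
exists M, p => x; eexists; split; first by rewrite /input_size /= addn0; exact: HM.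
have [S [[_ outS] Sk ap]] := HS x.
(* The gap makes the returned set pass if a tableau exists; conversely a passing set encodes a
   tableau. *)
rewrite (verdict_passes outS) vsat; split=> [ex|pS].
  apply: (approx_passes _ _ _ Sk ex ap (gap x)) => //.
  - by rewrite addn2.
  - exact: kM.
  - by rewrite /gc_factor lt_min ltr01 mulr_gt0 ?powR_gt0 ?ltr0n.
apply: passes_sat pS => //; first by rewrite addn2.
exact: kM.
Qed.

(** * The inclusion of P in NP *)

Section IgnoreCertificate.
Variable M : machine.
Let i1 : 'I_(ntapes M).+2 := @Ordinal (ntapes M).+2 1 isT.

(** The renumbering [lift i1] skips tape 1, on which the certificate stays untouched. *)
Definition ignore_certificate : machine :=
  @Machine (ntapes M).+1 (extra M) (state M) (start M) (@halting M)
    (fun q r => let qa := trans q [ffun j => r (lift i1 j)] in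
       (qa.1, [ffun i => if unlift i1 i is Some j then qa.2 j else (r i, Stay)])).

Lemma ignore_certificate_iter x w t :
  let c' := iter t (@step ignore_certificate) (init ignore_certificate [:: x; w]) in
  let c := iter t (@step M) (init M [:: x]) in
  c'.1 = c.1 /\ forall j, c'.2 (lift i1 j) = c.2 j.
Proof.
elim: t => [|t] /=.
  split=> // j; rewrite !ffunE; congr word_tape.
  by case: j => -[|j] jj //=; rewrite nth_nil /bump /= nth_nil.
move: (iter t _ _) (iter t _ _) => [q U] [q' U'] /= [-> eU].
rewrite /step /=; case: (halting q) => //=.
have -> : [ffun j => [ffun i => under_head (U' i)] (lift i1 j)] =
          [ffun i => under_head (U i)].
  by apply/ffunP => j; rewrite !ffunE eU.
case: (trans q _) => q1 act /=; split=> // j.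
by rewrite !ffunE liftK eU.
Qed.
End IgnoreCertificate.

Lemma P_sub_NP (L : language) : classP L -> classNP L.
Proof.
(* The length bound 0 admits only the empty certificate. *)
move=> [M [p HM]]; exists (fun xw => L xw.1), 0; split; last first.
  move=> x; split=> [Lx|[w [_ //]]].
  by exists [::]; split.
exists (ignore_certificate M), p => -[x w]; have [b [[h1 h2] Lb]] := HM x.
exists b; split=> //; rewrite /outputs_within -[(x, w).1]/x -[(x, w).2]/w.
have [e1 e2] := ignore_certificate_iter M x w p.[input_size [:: x]].
rewrite (iter_halting (s := p.[input_size [:: x]])).
- split; first by rewrite e1.
  rewrite -h2 /output -(e2 ord0).
  by have -> : lift (Ordinal (isT : (1 < (ntapes M).+2)%N)) ord0 = ord0 by apply: val_inj.
- by apply: horner_nat_mono; rewrite /input_size /= addn0 leq_addr.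
- by rewrite e1.
Qed.

(** An approximation algorithm would put all of NP into P, and the two inclusions would identify the
    classes. *)
Theorem theorem4p1 (R : realType) (eps : R) (heps : 0 < eps < 1 / 2)
    (hPNP : classP <> classNP) :
  ~ polytime_approximable_on_dags (gc_factor eps).
Proof.
move=> H; apply: hPNP; apply/seteqP; split=> L; first exact: P_sub_NP.
exact: NP_sub_P heps H.
Qed.
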